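(* Let $\alpha\in(0,1)$, $\beta\in(0,1]$, $0<L_0<L$, $\gamma\in(0,1)$, and let $f_0\in H(\beta,L_0)$ be a probability density on $\mathcal X\subset\mathbb R$. Let $B\subset\mathcal X$ be any nonempty compact set, partitioned into $N$ intervals of length $2h$ as described in the context, with bandwidth $h\asymp |B|^{-1/(4\beta+3)}(n\alpha^2)^{-2/(4\beta+3)}$. Let $\psi$ be a bounded function supported in $[-1,1]$ with $\int_{-1}^1\psi=1$ and $\int_{-1}^1|t|^\beta|\psi(t)|\,dt<\infty$. Then the non-interactive $\alpha$-locally differentially private mechanism and test $\Phi$ described in the context, with $$t_1=\frac32 L_0^2C_\beta^2Nh^{2\beta}+\frac{196\|\psi\|_\infty^2\sqrt N}{\gamma n\alpha^2h^2},\qquad t_2=\sqrt{\frac{20}{n\alpha^2\gamma}},\qquad C_\beta=\int_{-1}^1|u|^\beta|\psi(u)|\,du,$$ attain the following bound on the separation rate: $$\mathcal E^{\mathrm{NI}}_{n,\alpha}(f_0,\gamma)\le C(L,\gamma,\psi)\left\{|B|^{\frac{3\beta+3}{4\beta+3}}(n\alpha^2)^{-\frac{2\beta}{4\beta+3}}+\int_{\overline B}f_0+\frac1{\sqrt{n\alpha^2}}\right\},$$ where $C(L,\gamma,\psi)>0$ is a constant depending only on $L,\gamma,\psi$ (and on the constants implicit in $h\asymp\cdots$). That is, when $\rho$ equals the right-hand side, the sum of the type I error probability of $\Phi$ under $f_0$ and of its type II error probability, the latter taken in supremum over $H_1(\rho)$, is at most $\gamma$.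
   Context: **Model.** $\mathcal X\subset\mathbb R$; $X_1,X_2,\dots$ are i.i.d. with probability density $f:\mathcal X\to\mathbb R_+$. $H(\beta,L)=\{f:\mathcal X\to\mathbb R_+: |f(x)-f(y)|\le L|x-y|^\beta\ \forall x,y\in\mathcal X\}$. One tests $H_0: f\equiv f_0$ against $H_1(\rho)$: $f$ is a probability density in $H(\beta,L)$ with $\|f-f_0\|_1\ge\rho$. For $B\subset\mathcal X$, $\overline B=\mathcal X\setminus B$; $|B|$ is Lebesgue measure. $a\asymp b$ means each is bounded by a positive constant times the other. **Privacy.** A non-interactive mechanism is a family of Markov kernels $Q_i$ such that, independently over $i$, $Z_i\sim Q_i(\cdot\mid X_i=x_i)$ given $X_i=x_i$. It is $\alpha$-locally differentially private (LDP) if $Q_i(A\mid X_i=x)\le e^\alpha Q_i(A\mid X_i=x')$ for all $i$, all measurable $A$ and all $x,x'\in\mathcal X$. $\mathcal Q_\alpha^{\mathrm{NI}}$ is the set of these mechanisms, $\Phi_Q$ the set of $\{0,1\}$-valued tests based on the privatized sample, and $\mathbb P_{Q_f^n}$ the law of the privatized sample when the $X_i$ have density $f$. Define $$\mathcal R^{\mathrm{NI}}_{n,\alpha}(f_0,\rho)=\inf_{Q\in\mathcal Q^{\mathrm{NI}}_\alpha}\inf_{\phi\in\Phi_Q}\sup_{f\in H_1(\rho)}\{\mathbb P_{Q_{f_0}^n}(\phi=1)+\mathbb P_{Q_f^n}(\phi=0)\},\qquad \mathcal E^{\mathrm{NI}}_{n,\alpha}(f_0,\gamma)=\inf\{\rho>0:\mathcal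 R^{\mathrm{NI}}_{n,\alpha}(f_0,\rho)\le\gamma\}.$$ In this statement the total sample size is even and written $2n$ (with $n\ge2$): the observations are $X_1,\dots,X_{2n}$, and $\mathcal E^{\mathrm{NI}}_{n,\alpha}$ refers to this sample. **Partition.** $B=\bigcup_{j=1}^N B_j$ with $B_j=[x_j-h,x_j+h]$, $N\ge1$, so $|B|=2Nh$. Common endpoints of adjacent cells are disregarded: each $y$ is considered to be in at most one cell and $\psi((x_j-y)/h)\ne0$ for at most one $j$. **Mechanism and test.** For $1\le i\le n$, $1\le j\le N$: $Z_{ij}=\frac1h\psi\big(\frac{x_j-X_i}{h}\big)+\frac{2\|\psi\|_\infty}{\alpha h}W_{ij}$ with $W_{ij}$ i.i.d. Laplace(1) (density $\frac12e^{-|w|}$), independent of the data; $Z_i=(Z_{ij})_{j\le N}$. For $n+1\le i\le 2n$: $Z_i=\pm c_\alpha$ with (conditional on $X_i$) probabilities $\frac12\big(1\pm\frac{I(X_i\notin B)}{c_\alpha}\big)$, $c_\alpha=\frac{e^\alpha+1}{e^\alpha-1}$. Put $$S_B=\sum_{j=1}^N\frac1{n(n-1)}\sum_{1\le i\ne k\le n}(Z_{ij}-f_0(x_j))(Z_{kj}-f_0(x_j)),\qquad T_B=\frac1n\sum_{i=n+1}^{2n}Z_i-\int_{\overline B}f_0,$$ and $\Phi=1$ if $S_B\ge t_1$ or $T_B\ge t_2$, $\Phi=0$ otherwise. *)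

(* Defs.v *)
From HB Require Import structures.
From mathcomp Require Import all_boot all_order all_algebra.
From mathcomp Require Import all_classical all_reals all_analysis.
From mathcomp Require Import measurable_realfun.

Set Implicit Arguments.
Unset Strict Implicit.
Unset Printing Implicit Defensive.
Import Order.TTheory GRing.Theory Num.Theory.
Import numFieldNormedType.Exports.

Local Open Scope classical_set_scope.
Local Open Scope ring_scope.

Definition cylinders (m : nat) (d : 'I_m -> measure_display)
    (Z : forall i, measurableType (d i)) : set (set (forall i, Z i)) :=
  [set C | exists i (A : set (Z i)), measurable A /\ C = [set z | A (z i)]].

Arguments cylinders {m d} Z.

(* The product set [forall i, Z i] with the sigma-algebra generated by the
   coordinate maps. *)
Notation prodT Z := (g_sigma_algebraType (cylinders Z)).

Lemma measurable_coord (m : nat) (d : 'I_m -> measure_display)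
    (Z : forall i, measurableType (d i)) (i : 'I_m) :
  measurable_fun [set: prodT Z] (fun z : prodT Z => z i).
Proof.
move=> _ A mA; rewrite setTI.
by apply: sub_sigma_algebra; exists i, A.
Qed.

Lemma measurable_prodT (d0 : measure_display) (T : measurableType d0) (m : nat)
    (d : 'I_m -> measure_display) (Z : forall i, measurableType (d i))
    (f : T -> prodT Z) :
  (forall i, measurable_fun [set: T] (fun t => f t i)) ->
  measurable_fun [set: T] f.
Proof.
move=> mf; apply: (@measurability _ _ _ (prodT Z) setT f (cylinders Z)) => //.
move=> _ [_ [i [A [mA ->]]] <-].
exact: mf.
Qed.

Lemma dcons_exists (m : nat) (Z : 'I_m.+1 -> Type)
    (z0 : Z ord0) (z : forall i : 'I_m, Z (lift ord0 i)) :
  exists w : forall i, Z i, w ord0 = z0 /\ forall i, w (lift ord0 i) = z i.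
Proof.
have H i : {a : Z i | (forall e : i = ord0, a = ecast k (Z k) (esym e) z0) /\
    forall j (e : i = lift ord0 j), a = ecast k (Z k) (esym e) (z j)}.
  case: (unliftP ord0 i) => [j ->|->].
    exists (z j); split => [e|k e]; first by have /eqP ne := neq_lift ord0 j; case: (ne (esym e)).
    have ejk := lift_inj e; move: e; rewrite -ejk => e.
    by rewrite (eq_axiomK e).
  exists z0; split => [e|k e]; first by rewrite eq_axiomK.
  by have /eqP ne := neq_lift ord0 k; case: (ne e).
exists (fun i => sval (H i)); split => [|i].
  by have [+ _] := svalP (H ord0) => /(_ erefl).
by have [_ +] := svalP (H (lift ord0 i)) => /(_ i erefl).
Qed.

Lemma prod_prob_exists (R : realType) (m : nat) (d : 'I_m -> measure_display)
    (Z : forall i, measurableType (d i)) (P : forall i, probability (Z i) R) :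
  exists mu : probability (prodT Z) R,
    forall A : (forall i, set (Z i)), (forall i, measurable (A i)) ->
      mu [set z | forall i, A i (z i)] = (\prod_(i < m) P i (A i))%E.
Proof.
elim: m d Z P => [|m IH] d Z P.
  exists (dirac (point : prodT Z)).
  move=> A mA; rewrite big_ord0 /= diracE mem_set//=.
  by case.
have [mu' Hmu'] := IH _ (fun i => Z (lift ord0 i)) (fun i => P (lift ord0 i)).
pose cons (p : Z ord0 * prodT (fun i => Z (lift ord0 i))) : prodT Z :=
  sval (cid (dcons_exists p.1 p.2)).
have cons0 p : cons p ord0 = p.1 by rewrite /cons; case: cid => w [].
have consS p i : cons p (lift ord0 i) = p.2 i by rewrite /cons; case: cid => w [].
have mcons : measurable_fun setT cons.
  apply: measurable_prodT => i.
  case: (unliftP ord0 i) => [j ->|->].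
    have -> : (fun p => cons p (lift ord0 j)) = (fun p => p.2 j).
      by apply/funext => p; exact: consS.
    exact: (measurableT_comp (@measurable_coord _ _ _ j) measurable_snd).
  have -> : (fun p => cons p ord0) = fst by apply/funext => p; exact: cons0.
  exact: measurable_fst.
pose mc : {mfun (Z ord0 * prodT (fun i => Z (lift ord0 i)))%type >-> prodT Z} :=
  mfun_Sub (mem_set mcons).
exists (distribution (P ord0 \x mu')%E mc) => A mA.
rewrite big_ord_recl -Hmu'; last by move=> i; exact: mA.
have mB : measurable [set z : prodT (fun i => Z (lift ord0 i)) |
    forall i, A (lift ord0 i) (z i)].
  rewrite (_ : mkset _ = \bigcap_(i in [set: 'I_m])
      [set z : prodT (fun i => Z (lift ord0 i)) | A (lift ord0 i) (z i)]); last first.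
    by apply/seteqP; split => z /= H i; [move=> _|]; exact: H.
  apply: fin_bigcap_measurable => // i _.
  by apply: sub_sigma_algebra; exists i, (A (lift ord0 i)).
rewrite -product_measure1E //= /distribution /pushforward; congr (_ _).
apply/seteqP; split => [p H|p [H0 HS] i].
  split; first by rewrite -(cons0 p); exact: H.
  by move=> i; rewrite -(consS p); exact: H.
case: (unliftP ord0 i) => [j ->|->].
  by rewrite /= consS; exact: HS.
by rewrite /= cons0.
Qed.

(* The product measure: characterized by its values on boxes, which determine it
   since boxes form a pi-system generating the sigma-algebra. *)
Definition prod_prob {R : realType} (m : nat) (d : 'I_m -> measure_display)
    (Z : forall i, measurableType (d i)) (P : forall i, probability (Z i) R) :
    probability (prodT Z) R :=
  projT1 (cid (prod_prob_exists P)).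

Lemma prod_probE (R : realType) (m : nat) (d : 'I_m -> measure_display)
    (Z : forall i, measurableType (d i)) (P : forall i, probability (Z i) R)
    (A : forall i, set (Z i)) :
  (forall i, measurable (A i)) ->
  prod_prob P [set z | forall i, A i (z i)] = (\prod_(i < m) P i (A i))%E.
Proof. exact: (projT2 (cid (prod_prob_exists P))). Qed.

(* Probability densities on a Borel set [X]; the values outside [X] are
   irrelevant. *)
Record density (R : realType) (X : set R) := Density {
  dfun :> R -> R ;
  density_dom : measurable X ;
  density_ge0 : forall x, X x -> 0 <= dfun x ;
  density_meas : measurable_fun X dfun ;
  density_int1 : (\int[lebesgue_measure]_(x in X) (dfun x)%:E = 1)%E }.

Section density_law.
Context (R : realType) (X : set R) (f : density X).

Definition density_law : set R -> \bar R :=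
  fun A => (\int[lebesgue_measure]_(x in A `&` X) (f x)%:E)%E.

Let law0 : density_law set0 = 0%E.
Proof. by rewrite /density_law set0I integral_set0. Qed.

Let law_ge0 A : (0 <= density_law A)%E.
Proof. by apply: integral_ge0 => x [_ Xx]; rewrite lee_fin density_ge0. Qed.

Let law_sigma_additive : semi_sigma_additive density_law.
Proof.
move=> F mF tF mUF; rewrite /density_law; apply: cvg_toP.
  apply: ereal_nondecreasing_is_cvgn => m n mn.
  by apply: lee_sum_nneg_natr => // k _ _; exact: law_ge0.
have mX := density_dom f.
rewrite setI_bigcupl ge0_integral_bigcup//=.
- by move=> k; apply: (measurableI _ _ (mF k) mX).
- apply/measurable_EFinP; apply: measurable_funS (density_meas f) => //.
  by move=> x [k _ []].
- by move=> x [k _ [_ Xx]]; rewrite lee_fin density_ge0.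
- apply/trivIsetP => i j _ _ ij; rewrite setIACA setIid.
  by move/trivIsetP : tF => ->//; rewrite set0I.
Qed.

HB.instance Definition _ := isMeasure.Build _ _ _ density_law
  law0 law_ge0 law_sigma_additive.

Let law_setT : density_law setT = 1%E.
Proof. by rewrite /density_law setTI density_int1. Qed.

HB.instance Definition _ :=
  @Measure_isProbability.Build _ _ R density_law law_setT.

End density_law.

Section marginal.
Context (R : realType) (X : set R) (f : density X).
Context (d : measure_display) (Z : measurableType d) (Q : R.-pker R ~> Z).

(* The law of Z ~ Q(. | X = x) when X has density f. *)
Definition marginal : set Z -> \bar R :=
  fun A => (\int[density_law f]_x Q x A)%E.

Let marg0 : marginal set0 = 0%E.
Proof. by rewrite /marginal integral0_eq. Qed.

Let marg_ge0 A : (0 <= marginal A)%E.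
Proof. exact: integral_ge0. Qed.

Let marg_sigma_additive : semi_sigma_additive marginal.
Proof.
move=> F mF tF mUF; rewrite [X in _ --> X](_ : _ =
  \int[density_law f]_x (\sum_(n <oo) Q x (F n)))%E; last first.
  apply: eq_integral => x _.
  by apply/esym/cvg_lim => //; exact/measure_semi_sigma_additive.
apply/cvg_closeP; split.
  by apply: is_cvg_nneseries => n _ _; exact: integral_ge0.
rewrite closeE// integral_nneseries// => n.
exact: measurable_kernel.
Qed.

HB.instance Definition _ := isMeasure.Build _ _ _ marginal
  marg0 marg_ge0 marg_sigma_additive.

Let marg_setT : marginal setT = 1%E.
Proof.
rewrite /marginal -[RHS](probability_setT (density_law f)) -[RHS]mul1e -integral_cst//.
by apply: eq_integral => x _; rewrite prob_kernel.
Qed.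

HB.instance Definition _ :=
  @Measure_isProbability.Build _ _ R marginal marg_setT.

End marginal.

(* The law of (Z_i)_i when the X_i are i.i.d. with density f and, given the X_i,
   the Z_i are independent with Z_i ~ Q_i(. | X_i): the Z_i are then independent
   with laws [marginal f (Q i)]. *)
Definition private_law {R : realType} (X : set R) (m : nat)
    (d : 'I_m -> measure_display) (Z : forall i, measurableType (d i))
    (Q : forall i, R.-pker R ~> Z i) (f : density X) :
    probability (prodT Z) R :=
  prod_prob (fun i => (marginal f (Q i) : probability (Z i) R)).

Definition holder {R : realType} (X : set R) (beta L : R) (f : R -> R) : Prop :=
  forall x y, X x -> X y -> `|f x - f y| <= L * `|x - y| `^ beta.

Definition l1_dist {R : realType} (X : set R) (f g : R -> R) : \bar R :=
  (\int[lebesgue_measure]_(x in X) `|f x - g x|%:E)%E.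

Definition alternatives {R : realType} (X : set R) (beta L : R) (f0 : density X) (rho : R) :
    set (density X) :=
  [set f | holder X beta L f /\ (rho%:E <= l1_dist X f f0)%E].

(* Mechanisms are kernels on the whole line, of which only the values on [X]
   are constrained or used. *)
Definition ldp {R : realType} (X : set R) (alpha : R) (d : measure_display)
    (Z : measurableType d) (Q : R.-pker R ~> Z) : Prop :=
  forall (A : set Z) (x x' : R), measurable A -> X x -> X x' ->
    (Q x A <= (expR alpha)%:E * Q x' A)%E.

Definition type1_error {R : realType} (X : set R) (m : nat)
    (d : 'I_m -> measure_display) (Z : forall i, measurableType (d i))
    (Q : forall i, R.-pker R ~> Z i) (phi : prodT Z -> bool)
    (f0 : density X) : \bar R :=
  private_law Q f0 [set z | phi z].

Definition type2_error {R : realType} (X : set R) (m : nat)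
    (d : 'I_m -> measure_display) (Z : forall i, measurableType (d i))
    (Q : forall i, R.-pker R ~> Z i) (phi : prodT Z -> bool)
    (f : density X) : \bar R :=
  private_law Q f [set z | ~~ phi z].

(* Supremum of a set of nonnegative values, equal to 0 on the empty set
   (whereas [ereal_sup set0 = -oo]). *)
Definition sup_nonneg {R : realType} (E : set (\bar R)) : \bar R :=
  ereal_sup (E `|` [set 0%E]).

Definition minimax_risk {R : realType} (X : set R) (beta L : R) (m : nat)
    (alpha : R) (f0 : density X) (rho : R) : \bar R :=
  ereal_inf [set r | exists (d : 'I_m -> measure_display)
    (Z : forall i, measurableType (d i)) (Q : forall i, R.-pker R ~> Z i)
    (phi : prodT Z -> bool),
    [/\ forall i, ldp X alpha (Q i), measurable_fun [set: prodT Z] phi &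
      r = sup_nonneg [set (type1_error Q phi f0 + type2_error Q phi f)%E
               | f in alternatives beta L f0 rho]]].

Definition separation_rate {R : realType} (X : set R) (beta L : R) (m : nat)
    (alpha : R) (f0 : density X) (gamma : R) : \bar R :=
  ereal_inf [set rho%:E | rho in
    [set rho : R | 0 < rho /\
       (minimax_risk beta L m alpha f0 rho <= gamma%:E)%E]].

Definition laplace_pdf {R : realType} (w : R) : R := 2^-1 * expR (- `|w|).

Section laplace.
Context (R : realType).
Local Notation mu := (@lebesgue_measure R).

Let laplace_ge0 (w : R) : 0 <= laplace_pdf w.
Proof. by rewrite mulr_ge0 ?invr_ge0 ?expR_ge0. Qed.

Let laplace_cont : continuous (@laplace_pdf R).
Proof.
move=> w; apply: (@continuousM _ R^o (fun=> 2^-1) (fun w => expR (- `|w|))).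
  exact: cst_continuous.
apply: continuous_comp; last exact: continuous_expR.
by apply: (@continuousN _ R^o); exact: (@norm_continuous _ R^o).
Qed.

Let laplace_meas : measurable_fun setT (@laplace_pdf R).
Proof. exact: continuous_measurable_fun. Qed.

Let laplace_int1 : (\int[mu]_w (laplace_pdf w)%:E = 1)%E.
Proof.
rewrite ge0_symfun_integralT//; last by move=> w; rewrite /laplace_pdf /= normrN.
rewrite -ge0_integralZl//=; last 2 first.
- by apply/measurable_EFinP; exact: measurable_funTS.
- by move=> w _; rewrite lee_fin.
rewrite -(integral_exponential_pdf (@ltr01 R)) -set_itvcy integral_mkcond.
apply: eq_integral => w _; rewrite /exponential_pdf !patchE.
case: ifPn => // ; rewrite inE /= in_itv/= andbT => w0.
by rewrite /laplace_pdf -EFinM mulrA mulfV// !mul1r mulN1r ger0_norm.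
by rewrite -set_itvcy; exact: measurable_itv.
Qed.

Definition laplace_density : density [set: R] :=
  Density measurableT (fun w _ => laplace_ge0 w) laplace_meas laplace_int1.

Definition laplace : probability R R := density_law laplace_density.

End laplace.
Arguments laplace : clear implicits.

(* The law of [g (x, W)] given [x], where [W] has law [l x] given [x]. *)
Section randomize.
Context (R : realType) (d1 d2 d3 : measure_display).
Context (T : measurableType d1) (W : measurableType d2) (Z : measurableType d3).
Context (l : R.-pker T ~> W) (g : T * W -> Z) (mg : measurable_fun setT g).

Definition randomize : T -> {measure set Z -> \bar R} :=
  mkcomp l (kdirac mg).

HB.instance Definition _ := SFiniteKernel.on randomize.

Lemma randomizeE x (A : set Z) : measurable A ->
  randomize x A = l x [set w | A (g (x, w))].
Proof.
move=> mA; rewrite /randomize/= /mkcomp/= /kcomp/=.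
have mB : measurable [set w | A (g (x, w))].
  rewrite -[X in measurable X]setTI.
  exact: (measurableT_comp mg (pair1_measurable x)).
rewrite -[in RHS](setIT [set w | _]) -integral_indic//.
Qed.

Let randomize_prob x : randomize x [set: Z] = 1%E.
Proof. by rewrite randomizeE// prob_kernel. Qed.

HB.instance Definition _ :=
  Kernel_isProbability.Build _ _ _ _ R randomize randomize_prob.

End randomize.

(* [N] cells with centres [ctr j] and half-width [hw]; [lclosed j] and
   [rclosed j] tell whether the cell contains its left and right endpoint. *)
Record grid (R : realType) (N : nat) := Grid {
  ctr : 'I_N -> R ;
  hw : R ;
  lclosed : 'I_N -> bool ;
  rclosed : 'I_N -> bool }.

Definition cell {R : realType} (N : nat) (G : grid R N) (j : 'I_N) : set R :=
  [set` Interval (BSide (lclosed G j) (ctr G j - hw G))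
                 (BSide (~~ rclosed G j) (ctr G j + hw G))].

Definition closed_cell {R : realType} (N : nat) (G : grid R N) (j : 'I_N) :
    set R :=
  `[ctr G j - hw G, ctr G j + hw G].

(* The cells [cell G j] partition the union [B] of the closed cells: a common
   endpoint of two adjacent closed cells is attributed to exactly one of them
   (to which one is left arbitrary). *)
Definition grid_partition {R : realType} (N : nat) (G : grid R N) (B : set R) :
    Prop :=
  [/\ 0 < hw G, B = \bigcup_j closed_cell G j, B = \bigcup_j cell G j &
      trivIset [set: 'I_N] (cell G)].

Definition sup_norm {R : realType} (psi : R -> R) : R :=
  sup [set `|psi u| | u in [set: R]].

Section mechanism.
Context (R : realType) (alpha : R) (psi : {mfun R >-> R}).
Context (N : nat) (G : grid R N).
Local Notation h := (hw G).

(* The restriction to [cell G j] implements the convention that each [y] is in at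
   most one cell; it changes nothing in the interior of the closed cells, nor,
   [psi] being supported in [-1, 1], outside of them. *)
Definition smooth (j : 'I_N) (y : R) : R :=
  h^-1 * psi ((ctr G j - y) / h) * \1_(cell G j) y.

Definition noisy (p : R * prodT (fun _ : 'I_N => R)) : prodT (fun _ : 'I_N => R) :=
  fun j => smooth j p.1 + 2 * sup_norm psi / (alpha * h) * p.2 j.

Lemma measurable_smooth j : measurable_fun [set: R] (smooth j).
Proof.
apply: measurable_funM; last first.
  by apply: measurable_indic; exact: measurable_itv.
apply: measurable_funM => //; apply: measurableT_comp => //.
by apply: measurable_funM => //; exact: measurable_funB.
Qed.

Lemma measurable_noisy : measurable_fun setT noisy.
Proof.
apply: measurable_prodT => j; apply: measurable_funD.
  exact: (measurableT_comp (measurable_smooth j) measurable_fst).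
apply: measurable_funM => //.
exact: (measurableT_comp (@measurable_coord _ _ (fun _ : 'I_N => R : measurableType _) j) measurable_snd).
Qed.

Definition laplace_noise : pprobability (prodT (fun _ : 'I_N => R)) R :=
  prod_prob (fun _ => laplace R).

Definition smooth_kernel : R.-pker R ~> prodT (fun _ : 'I_N => R) :=
  randomize (kprobability (measurable_cst laplace_noise)) measurable_noisy.

Definition c_alpha : R := (expR alpha + 1) / (expR alpha - 1).

Definition out_prob (x : R) : R :=
  2^-1 * (1 + \1_(~` \bigcup_j closed_cell G j) x / c_alpha).

Lemma measurable_out_prob :
  measurable_fun [set: R] (fun x => bernoulli_prob (out_prob x) : pprobability bool R).
Proof.
apply: (measurableT_comp measurable_bernoulli_prob).
apply: measurable_funM => //; apply: measurable_funD => //.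
apply: measurable_funM => //; apply: measurable_indic.
apply: measurableC; apply: fin_bigcup_measurable => // j _; exact: measurable_itv.
Qed.

Definition signed (p : R * bool) : R := if p.2 then c_alpha else - c_alpha.

Lemma measurable_signed : measurable_fun setT signed.
Proof.
rewrite /signed; apply: measurable_fun_if => //.
Qed.

Definition sign_kernel : R.-pker R ~> R :=
  randomize (kprobability measurable_out_prob) measurable_signed.

End mechanism.

(* Output space of one observation: R^N in the first half of the sample, R in
   the second half. *)
Definition out_disp (R : realType) (N : nat) (first : bool) : measure_display :=
  if first then (cylinders (fun _ : 'I_N => (R : measurableType _))).-sigma%mdisp
  else default_measure_display.

Definition out (R : realType) (N : nat) (first : bool) :
    measurableType (out_disp R N first) :=
  if first return measurableType (out_disp R N first)
  then prodT (fun _ : 'I_N => R) else R.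

Definition out_vec {R : realType} (N : nat) (first : bool) :
    out R N first -> 'I_N -> R :=
  if first return out R N first -> 'I_N -> R then (fun z => z) else (fun _ _ => 0).

Definition out_real {R : realType} (N : nat) (first : bool) :
    out R N first -> R :=
  if first return out R N first -> R then (fun _ => 0) else (fun z => z).

Definition half_kernel {R : realType} (alpha : R) (psi : {mfun R >-> R})
    (N : nat) (G : grid R N) (first : bool) : R.-pker R ~> out R N first :=
  if first return R.-pker R ~> out R N first
  then smooth_kernel alpha psi G else sign_kernel alpha G.

Definition mechanism {R : realType} (alpha : R) (psi : {mfun R >-> R})
    (N : nat) (G : grid R N) (n : nat) (i : 'I_(n + n)) :
    R.-pker R ~> out R N (i < n)%N :=
  half_kernel alpha psi G (i < n)%N.

Definition sample (R : realType) (N n : nat) :=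
  prodT (fun i : 'I_(n + n) => out R N (i < n)%N).

Definition Zvec {R : realType} (N n : nat) (z : sample R N n) (i : 'I_n)
    (j : 'I_N) : R :=
  out_vec (z (lshift n i)) j.

Definition Zreal {R : realType} (N n : nat) (z : sample R N n) (i : 'I_n) : R :=
  out_real (z (rshift n i)).

Definition S_stat {R : realType} (N n : nat) (G : grid R N) (f0 : R -> R)
    (z : sample R N n) : R :=
  \sum_(j < N) (n%:R * (n%:R - 1))^-1 *
    \sum_(i < n) \sum_(k < n | k != i)
      (Zvec z i j - f0 (ctr G j)) * (Zvec z k j - f0 (ctr G j)).

Definition T_stat {R : realType} (X : set R) (N n : nat) (B : set R)
    (f0 : R -> R) (z : sample R N n) : R :=
  n%:R^-1 * (\sum_(i < n) Zreal z i) -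
    (\int[lebesgue_measure]_(x in X `\` B) f0 x)%R.

Definition Phi {R : realType} (X : set R) (N n : nat) (G : grid R N) (B : set R)
    (f0 : R -> R) (t1 t2 : R) (z : sample R N n) : bool :=
  (t1 <= S_stat G f0 z) || (t2 <= T_stat X B f0 z).

Definition C_beta {R : realType} (beta : R) (psi : R -> R) : R :=
  (\int[lebesgue_measure]_(u in `[-1, 1]) (`|u| `^ beta * `|psi u|))%R.

Definition thr1 {R : realType} (alpha beta gamma L0 : R) (psi : R -> R)
    (N n : nat) (h : R) : R :=
  3 / 2 * L0 ^+ 2 * C_beta beta psi ^+ 2 * N%:R * h `^ (2 * beta) +
  196 * sup_norm psi ^+ 2 * Num.sqrt N%:R /
    (gamma * n%:R * alpha ^+ 2 * h ^+ 2).

Definition thr2 {R : realType} (alpha gamma : R) (n : nat) : R :=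
  Num.sqrt (20 / (n%:R * alpha ^+ 2 * gamma)).

Definition vol {R : realType} (B : set R) : R := fine (lebesgue_measure B).

Definition bandwidth {R : realType} (alpha beta : R) (n : nat) (B : set R) : R :=
  vol B `^ (- (1 / (4 * beta + 3))) *
  (n%:R * alpha ^+ 2) `^ (- (2 / (4 * beta + 3))).

Definition rate {R : realType} (alpha beta : R) (X : set R) (n : nat)
    (f0 : R -> R) (B : set R) : R :=
  vol B `^ ((3 * beta + 3) / (4 * beta + 3)) *
    (n%:R * alpha ^+ 2) `^ (- (2 * beta / (4 * beta + 3))) +
  (\int[lebesgue_measure]_(x in X `\` B) f0 x)%R +
  1 / Num.sqrt (n%:R * alpha ^+ 2).

(* Main.v *)
Require Import Defs.
From HB Require Import structures.
From mathcomp Require Import all_boot all_order all_algebra.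
From mathcomp Require Import all_classical all_reals all_analysis.
From mathcomp Require Import ring lra measurable_realfun.
Import Order.TTheory GRing.Theory Num.Theory.
Import numFieldNormedType.Exports.

(** Privacy is a statement about the Laplace density: translating it by [t]
    multiplies it by at most [expR `|t|] ([laplace_shift]).  Since the cells are
    disjoint, replacing [x] by [x'] moves the vector of smoothed values by at
    most [2 M / h] in l1 norm, where [M] is the sup norm of [psi], and the noise
    scale [2 M / (alpha h)] turns this into the factor [expR alpha] for the
    product of the noise laws ([prod_prob_dominated], [ldp_smooth_kernel]).  The
    signs sent by the second half of the sample are private by the choice of
    [c_alpha] ([ldp_sign_kernel]).

    For the test everything rests on Chebyshev's inequality.  Write [m_j] for
    the mean of [Z_ij] under the density [f] and [b_j = m_j - f0 (x_j)].  Then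
    [S_B] has mean [y = \sum_j b_j ^ 2], and [S_B - y] is the sum of a degenerate
    U-statistic and of a linear statistic.  Monomials in centred independent
    variables are orthogonal when their index sets differ
    ([monomial_orthogonal]), which gives both variances
    ([has_integral_ustat_sq], [has_integral_linear_sq]).  At each point at most
    one smoothed coordinate is nonzero, so their covariance matrix is a
    diagonal matrix minus one of rank one ([smooth_moments]); the noise
    contributes [8 M^2 / (alpha h)^2] on the diagonal.  With
    [s = sqrt N * M^2 / (n alpha^2 h^2)] this yields
    [E (S_B - y)^2 <= 656 s^2 + 72 s y] ([S_stat_second_moment],
    [S_stat_chebyshev]).  Likewise [T_B] has mean
    [tau = \int_(~` B) f - \int_(~` B) f0] and variance at most
    [9 / (n alpha^2)] ([T_stat_second_moment]).

    Under [f0] one has [tau = 0], and [y] is at most the squared bias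
    [N (L0 C_beta h^beta)^2] of the kernel estimator ([smooth_bias]).  The
    thresholds exceed these means by enough for a type I error of at most
    [9/10 gamma] ([type1_error_le]).

    Under an alternative, either [tau] is large and [T_B] rejects
    ([type2_error_outside]), or the mass of [f] outside of [B] hardly exceeds
    that of [f0], so that [f] and [f0] must differ on [B].  As both are Hoelder
    continuous, their L1 distance on [B] is controlled by their differences at
    the centres ([l1_dist_le]), hence by [h sqrt (N y)] up to a constant factor and bias
    terms; so [y] is large ([squared_bias_large]) and [S_B] rejects ([type2_error_inside]).  The
    bandwidth is the one which makes the bias [|B| h^beta] and the noise
    [N^(3/4) / sqrt (n alpha^2)] of the same order, that of the first term of
    the rate ([bandwidth_balance], [rate_dominates]). *)

Set Implicit Arguments.
Unset Strict Implicit.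
Unset Printing Implicit Defensive.
Local Open Scope classical_set_scope.
Local Open Scope ring_scope.

(** * Integrals and Chebyshev's inequality *)

(** Integrability and the value of the integral are recorded together, so that
    expectations are computed by linearity without side conditions. *)
Definition has_integral {R : realType} {d : measure_display} {T : measurableType d}
    (mu : {measure set T -> \bar R}) (X : T -> R) (m : R) : Prop :=
  mu.-integrable setT (EFin \o X) /\ (\int[mu]_x (X x)%:E = m%:E)%E.

Section has_integral_theory.
Context {R : realType} {d : measure_display} {T : measurableType d}.
Variable mu : {measure set T -> \bar R}.
Implicit Types (X Y : T -> R) (m c : R).

Lemma has_integral_measurable X m : has_integral mu X m -> measurable_fun setT X.
Proof. by move=> [/measurable_int/measurable_EFinP]. Qed.

Lemma has_integral_uniq X m m' : has_integral mu X m -> has_integral mu X m' -> m = m'.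
Proof. by move=> [_ e] [_]; rewrite e => -[]. Qed.

Lemma eq_has_integral X Y m : (forall x, X x = Y x) ->
  has_integral mu X m -> has_integral mu Y m.
Proof. by move=> /funext ->. Qed.

Lemma has_integralD X Y m m' : has_integral mu X m -> has_integral mu Y m' ->
  has_integral mu (fun x => X x + Y x) (m + m').
Proof.
move=> [iX eX] [iY eY]; split.
  exact: (integrableD measurableT iX iY).
by rewrite integralD_EFin// eX eY -EFinD.
Qed.

Lemma has_integralZ c X m : has_integral mu X m ->
  has_integral mu (fun x => c * X x) (c * m).
Proof.
move=> [iX eX]; split; first exact: (integrableZl measurableT c iX).
under eq_integral do rewrite EFinM.
by rewrite integralZl// eX -EFinM.
Qed.

Lemma has_integral0 : has_integral mu (fun=> 0) 0.
Proof. by split; [exact: integrable0|rewrite integral0]. Qed.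

Lemma has_integral_sum (I : Type) (r : seq I) (P : pred I) (X : I -> T -> R)
    (m : I -> R) : (forall i, P i -> has_integral mu (X i) (m i)) ->
  has_integral mu (fun x => \sum_(i <- r | P i) X i x) (\sum_(i <- r | P i) m i).
Proof.
move=> XM; elim: r => [|i r IH].
  rewrite big_nil; apply: eq_has_integral has_integral0 => x; by rewrite big_nil.
rewrite big_cons; under [X in has_integral _ X]eq_fun do rewrite big_cons.
case: (boolP (P i)) => Pi //; exact: has_integralD (XM _ Pi) IH.
Qed.

Lemma has_integral_le X Y m m' : (forall x, X x <= Y x) ->
  has_integral mu X m -> has_integral mu Y m' -> m <= m'.
Proof.
move=> XY [iX eX] [iY eY]; rewrite -lee_fin -eX -eY.
by apply: le_integral => // x _; rewrite lee_fin.
Qed.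

Lemma has_integral_ge0 X m : (forall x, 0 <= X x) -> has_integral mu X m -> 0 <= m.
Proof. by move=> X0; exact: (has_integral_le X0 has_integral0). Qed.

Lemma has_integral_dom X Y m : measurable_fun setT X ->
  (forall x, `|X x| <= Y x) -> has_integral mu Y m -> exists m', has_integral mu X m'.
Proof.
move=> mX XY [iY _].
have iX : mu.-integrable setT (EFin \o X).
  apply: le_integrable iY => //; first exact/measurable_EFinP.
  by move=> x _; rewrite /= lee_fin (le_trans (XY x))// ler_norm.
exists (fine (\int[mu]_x (X x)%:E)); split=> //.
by rewrite fineK//; exact: integrable_fin_num.
Qed.

Lemma has_integral_norm X m : has_integral mu X m ->
  exists2 m', has_integral mu (fun x => `|X x|) m' & `|m| <= m'.
Proof.
move=> XM; have mX := has_integral_measurable XM; case: (XM) => iX _.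
have iN : mu.-integrable setT (EFin \o (fun x => `|X x|)) by exact: integrable_norm.
have NM : has_integral mu (fun x => `|X x|) (fine (\int[mu]_x `|X x|%:E)).
  by split=> //; rewrite fineK//; exact: integrable_fin_num.
exists (fine (\int[mu]_x `|X x|%:E)) => //.
rewrite ler_norml -[X in X <= _ <= _]mulN1r; apply/andP; split.
  by apply: has_integral_le (has_integralZ (-1) NM) XM => x; rewrite mulN1r lerNl -normrN ler_norm.
by apply: has_integral_le XM NM => x; exact: ler_norm.
Qed.

Lemma eq_has_integral_ae (E : set T) X Y m : measurable E -> mu E = 0%E ->
  measurable_fun setT Y -> (forall x, ~ E x -> X x = Y x) ->
  has_integral mu X m -> has_integral mu Y m.
Proof.
move=> mE E0 mY XY [iX eX].
have XYae : ae_eq mu setT (EFin \o X) (EFin \o Y).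
  exists E; split => // x /= /not_implyP[_ nXY].
  by apply: contrapT => nE; apply: nXY; rewrite XY.
have mX : measurable_fun setT (EFin \o X) by case/integrableP : iX.
have mEY : measurable_fun setT (EFin \o Y) by exact/measurable_EFinP.
split.
  apply/integrableP; split => //; move/integrableP : iX => [_].
  congr (_ < _)%E; apply: ae_eq_integral => //.
  - exact: measurableT_comp.
  - exact: measurableT_comp.
  - exact: (ae_eq_comp abse).
by rewrite -eX; apply/esym/ae_eq_integral.
Qed.

Lemma has_integral_indic_measure (A : set T) c : measurable A -> mu A = c%:E ->
  has_integral mu (\1_A) c.
Proof.
move=> mA muA; have e : (\int[mu]_x (\1_A x)%:E = c%:E)%E by rewrite integral_indic// setIT.
split=> //; apply/integrableP; split; first exact/measurable_EFinP.
rewrite (_ : (\int[_]_x _)%E = c%:E) ?ltry// -e.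
by apply: eq_integral => x _; rewrite /= ger0_norm// indicE.
Qed.

End has_integral_theory.

Section has_integral_probability.
Context {R : realType} {d : measure_display} {T : measurableType d}.
Variable P : probability T R.

Lemma has_integral_cst c : has_integral P (fun=> c) c.
Proof.
split; first exact: finite_measure_integrable_cst.
transitivity (c%:E * P setT)%E; first exact: integral_cst.
by rewrite probability_setT mule1.
Qed.

Lemma has_integral_bounded (X : T -> R) M : measurable_fun setT X ->
  (forall x, `|X x| <= M) -> exists m, has_integral P X m.
Proof. by move=> mX XM; apply: has_integral_dom XM (has_integral_cst M). Qed.

Lemma has_integral_indic (A : set T) : measurable A ->
  has_integral P (\1_A) (fine (P A)).
Proof. by move=> mA; apply: has_integral_indic_measure; rewrite // fineK// fin_num_measure. Qed.

(** Chebyshev's inequality in the form in which the tests use it: the deviation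
    [Y] need not be centred, only its second moment matters. *)
Lemma chebyshev_second_moment (Y : T -> R) s e (A : set T) : measurable A -> 0 < e ->
  (forall x, A x -> e <= `|Y x|) ->
  has_integral P (fun x => Y x ^+ 2) s -> (P A <= (s / e ^+ 2)%:E)%E.
Proof.
move=> mA e0 AY Ys; have eA := has_integralZ (e ^+ 2) (has_integral_indic mA).
rewrite -[P A]fineK ?fin_num_measure// lee_fin ler_pdivlMr ?exprn_gt0// mulrC.
apply: has_integral_le eA Ys => x; rewrite indicE.
case: (boolP (x \in A)) => [/set_mem/AY eY|_]; last by rewrite mulr0 sqr_ge0.
by rewrite mulr1 -[leRHS]real_normK ?num_real// lerXn2r// nnegrE ltW.
Qed.

End has_integral_probability.

(** Positive and negative parts reduce a change of measure to its validity for
    nonnegative functions, which is how push-forwards, densities and changes of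
    variables are first obtained. *)
Lemma has_integral_transfer {R : realType} {d d' : measure_display}
    {T : measurableType d} {U : measurableType d'}
    (mu : {measure set T -> \bar R}) (nu : {measure set U -> \bar R})
    (phi : T -> U) (w : T -> R) :
  measurable_fun setT phi -> measurable_fun setT w -> (forall x, 0 <= w x) ->
  (forall g : U -> \bar R, measurable_fun setT g -> (forall y, 0 <= g y)%E ->
    (\int[nu]_y g y = \int[mu]_x (g (phi x) * (w x)%:E))%E) ->
  forall X m, measurable_fun setT X ->
  has_integral nu X m <-> has_integral mu (fun x => X (phi x) * w x) m.
Proof.
move=> mphi mw w0 E X m mX.
have mXw : measurable_fun setT (fun x => X (phi x) * w x).
  by apply: measurable_funM => //; exact: measurableT_comp.
have mEX : measurable_fun setT (EFin \o X) by exact/measurable_EFinP.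
have eX : (\int[nu]_y (X y)%:E = \int[mu]_x (X (phi x) * w x)%:E)%E.
  rewrite [LHS]integralE [RHS]integralE; congr (_ - _)%E.
    rewrite E//; last exact: measurable_funepos.
    apply: eq_integral => x _; rewrite !funeposE/= -!EFin_max -EFinM.
    by rewrite maxr_pMl// mul0r.
  rewrite E//; last exact: measurable_funeneg.
  apply: eq_integral => x _; rewrite !funenegE/= -!EFin_max -EFinM.
  by rewrite maxr_pMl// mul0r mulNr.
have eN : (\int[nu]_y `|(X y)%:E| = \int[mu]_x `|(X (phi x) * w x)%:E|)%E.
  rewrite E//; last exact: measurableT_comp.
  by apply: eq_integral => x _; rewrite !abse_EFin -EFinM normrM (ger0_norm (w0 x)).
rewrite /has_integral eX; split=> -[/integrableP[_ i] ->]; split=> //; apply/integrableP.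
  by split; [exact/measurable_EFinP|rewrite -eN].
by split; [exact/measurable_EFinP|rewrite /= eN].
Qed.

Lemma has_integral_distribution {R : realType} {d d' : measure_display}
    {T : measurableType d} {U : measurableType d'} (P : probability T R)
    (phi : {mfun T >-> U}) (X : U -> R) m : measurable_fun setT X ->
  has_integral (distribution P phi) X m <-> has_integral P (fun x => X (phi x)) m.
Proof.
move=> mX.
rewrite (@has_integral_transfer _ _ _ _ _ P _ phi (cst 1))//.
  by split; apply: eq_has_integral => x; rewrite mulr1.
move=> g mg g0; rewrite ge0_integral_distribution//.
by apply: eq_integral => x _; rewrite mule1.
Qed.

Lemma has_integral_prod {R : realType} {d1 d2 : measure_display}
    {T1 : measurableType d1} {T2 : measurableType d2}
    (P1 : probability T1 R) (P2 : probability T2 R) (X : T1 -> R) (Y : T2 -> R) m1 m2 :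
  has_integral P1 X m1 -> has_integral P2 Y m2 ->
  has_integral (P1 \x P2)%E (fun z => X z.1 * Y z.2) (m1 * m2).
Proof.
move=> XM YM; have mX := has_integral_measurable XM.
have mY := has_integral_measurable YM.
have mXY : measurable_fun setT (fun z : T1 * T2 => X z.1 * Y z.2).
  by apply: measurable_funM; exact: measurableT_comp.
have [n1 [iX eX] _] := has_integral_norm XM; have [n2 [iY eY] _] := has_integral_norm YM.
have iXY : (P1 \x P2)%E.-integrable setT (EFin \o (fun z : T1 * T2 => X z.1 * Y z.2)).
  apply/integrable12ltyP; first exact/measurable_EFinP.
  rewrite (_ : (\int[P1]_x _)%E = (n1 * n2)%:E) ?ltry//.
  rewrite EFinM -eX muleC -integralZl//; apply: eq_integral => x _.
  rewrite muleC -eY -integralZl//; apply: eq_integral => y _.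
  by rewrite /= normrM EFinM.
split=> //; rewrite -integral12_prod_meas1//=.
case: XM YM => jX fX [jY fY].
rewrite EFinM -fX muleC -integralZl//; apply: eq_integral => x _.
by rewrite muleC -fY -integralZl//.
Qed.

(** * Products of probability measures *)

Section product.
Context {R : realType}.

Lemma prod_prob_unique (m : nat) (d : 'I_m -> measure_display)
    (Z : forall i, measurableType (d i)) (P Q : probability (prodT Z) R) :
  (forall A : (forall i, set (Z i)), (forall i, measurable (A i)) ->
     P [set z | forall i, A i (z i)] = Q [set z | forall i, A i (z i)]) ->
  forall C, measurable C -> P C = Q C.
Proof.
move=> PQ C mC.
pose boxes := [set B : set (prodT Z) | exists2 A : (forall i, set (Z i)),
  (forall i, measurable (A i)) & B = [set z | forall i, A i (z i)]].
have mbox A : (forall i, measurable (A i)) ->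
    measurable [set z : prodT Z | forall i, A i (z i)].
  move=> mA; rewrite (_ : mkset _ = \bigcap_(i in [set: 'I_m]) [set z : prodT Z | A i (z i)]).
    apply: fin_bigcap_measurable => // i _.
    by apply: sub_sigma_algebra; exists i, (A i).
  by apply/seteqP; split => z /= H i; [move=> _|]; exact: H.
apply: (@measure_unique _ _ _ boxes (fun=> setT)) => //.
- apply/seteqP; split => [B mB|B].
    apply: (@smallest_sub _ (sigma_algebra setT) (cylinders Z) (<<s boxes >>) _ _ B mB).
      exact: smallest_sigma_algebra.
    move=> _ [i [A [mA ->]]]; apply: sub_sigma_algebra.
    exists (fun k => [set a | forall e : i = k, A (ecast k (Z k) (esym e) a)]); last first.
      apply/seteqP; split => z /=; last by move/(_ i erefl).
      by move=> Az k e; case: _ / e.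
    move=> k; case: (eqVneq i k) => [e|ik].
      case: _ / e; rewrite (_ : mkset _ = A)//.
      by apply/seteqP; split => a /= Aa; [exact: (Aa erefl)|move=> e; rewrite eq_axiomK].
    by rewrite (_ : mkset _ = setT)//; apply/seteqP; split => a //= _ e; rewrite e eqxx in ik.
  apply: smallest_sub; first exact: sigma_algebra_measurable.
  by move=> _ [A mA ->]; exact: mbox.
- move=> _ _ [A mA ->] [A' mA' ->]; exists (fun i => A i `&` A' i).
    by move=> i; exact: measurableI.
  by apply/seteqP; split => z /= => [[H H'] i|H]; split=> // i; case: (H i).
- by move=> _; exists (fun=> setT) => //; apply/seteqP; split.
- by apply/seteqP; split => // z _; exists 0%N.
- by move=> _ [A mA ->]; exact: PQ.
- by move=> _; rewrite -ge0_fin_numE ?fin_num_measure.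
Qed.

Section cons.
Context (m : nat) (d : 'I_m.+1 -> measure_display) (Z : forall i, measurableType (d i)).
Let tail := prodT (fun i => Z (lift ord0 i)).

Definition prod_cons (p : Z ord0 * tail) : prodT Z := sval (cid (dcons_exists p.1 p.2)).

Lemma prod_cons0 p : prod_cons p ord0 = p.1.
Proof. by rewrite /prod_cons; case: cid => w []. Qed.

Lemma prod_consS p i : prod_cons p (lift ord0 i) = p.2 i.
Proof. by rewrite /prod_cons; case: cid => w []. Qed.

Lemma measurable_prod_cons : measurable_fun setT prod_cons.
Proof.
apply: measurable_prodT => i; case: (unliftP ord0 i) => [j ->|->].
  have -> : (fun p => prod_cons p (lift ord0 j)) = (fun p => p.2 j).
    by apply/funext => p; exact: prod_consS.
  exact: (measurableT_comp (@measurable_coord _ _ _ j) measurable_snd).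
have -> : (fun p => prod_cons p ord0) = fst by apply/funext => p; exact: prod_cons0.
exact: measurable_fst.
Qed.

HB.instance Definition _ := isMeasurableFun.Build _ _ _ _ prod_cons measurable_prod_cons.

(** This recursive description of the product measure is what turns Fubini's
    theorem for two factors into statements about any number of factors. *)
Lemma prod_prob_cons (P : forall i, probability (Z i) R) (C : set (prodT Z)) :
  measurable C ->
  prod_prob P C =
  distribution (P ord0 \x prod_prob (fun i => P (lift ord0 i)))%E prod_cons C.
Proof.
apply: prod_prob_unique => A mA; rewrite prod_probE// big_ord_recl -prod_probE//.
rewrite -product_measure1E//; last first.
  rewrite (_ : mkset _ = \bigcap_(i in [set: 'I_m])
      [set z : tail | A (lift ord0 i) (z i)]); last first.
    by apply/seteqP; split => z /= H i; [move=> _|]; exact: H.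
  apply: fin_bigcap_measurable => // i _.
  by apply: sub_sigma_algebra; exists i, (A (lift ord0 i)).
rewrite /distribution /pushforward /=; congr (_ _).
apply/seteqP; split => [p [H0 HS] i|p H]; rewrite /=.
  by case: (unliftP ord0 i) => [j ->|->]; rewrite ?prod_consS ?prod_cons0.
by split=> [|i]; [rewrite -prod_cons0|rewrite -prod_consS]; exact: H.
Qed.

End cons.

Lemma eq_has_integral_measure {d} {T : measurableType d} (mu nu : {measure set T -> \bar R}) X c :
  (forall A, measurable A -> mu A = nu A) -> has_integral mu X c -> has_integral nu X c.
Proof.
move=> E; have eI g : (\int[mu]_x g x = \int[nu]_x g x)%E.
  by apply: eq_measure_integral => A mA _; exact: E.
by move=> [/integrableP[mX iX] eX]; split; [apply/integrableP; split=> //|]; rewrite -eI.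
Qed.

(** This form of the independence of the coordinates, obtained by splitting off one
    coordinate at a time, is the only one used below. *)
Lemma has_integral_prod_prob (m : nat) (d : 'I_m -> measure_display)
    (Z : forall i, measurableType (d i)) (P : forall i, probability (Z i) R)
    (g : forall i, Z i -> R) (c : 'I_m -> R) :
  (forall i, has_integral (P i) (g i) (c i)) ->
  has_integral (prod_prob P) (fun z => \prod_i g i (z i)) (\prod_i c i).
Proof.
elim: m d Z P g c => [|m IH] d Z P g c gc.
  rewrite big_ord0; apply: eq_has_integral (has_integral_cst _ 1) => z.
  by rewrite big_ord0.
have mg : measurable_fun setT (fun z : prodT Z => \prod_i g i (z i)).
  apply: measurable_prod => i _.
  exact: (measurableT_comp (has_integral_measurable (gc i)) (@measurable_coord _ _ Z i)).
have mh := has_integral_prod (gc ord0)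
  (IH _ _ _ _ _ (fun i => gc (lift ord0 i))).
apply: (eq_has_integral_measure (fun C mC => esym (prod_prob_cons P mC))).
apply/has_integral_distribution => //.
rewrite big_ord_recl; apply: eq_has_integral mh => p /=.
rewrite big_ord_recl prod_cons0; congr (_ * _).
by apply: eq_bigr => i _; rewrite prod_consS.
Qed.

(** Domination passes to products, one factor at a time: both iterated
    integrals of a section compute the product measure, so only sections need to
    be compared. *)
Lemma prod_prob_dominated (m : nat) (d : 'I_m -> measure_display)
    (Z : forall i, measurableType (d i)) (P Q : forall i, probability (Z i) R)
    (c : 'I_m -> R) :
  (forall i A, measurable A -> P i A <= (c i)%:E * Q i A)%E -> (forall i, 0 <= c i) ->
  forall C, measurable C -> (prod_prob P C <= (\prod_i c i)%:E * prod_prob Q C)%E.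
Proof.
elim: m d Z P Q c => [|m IH] d Z P Q c PQ c0 C mC.
  rewrite big_ord0 mul1e le_eqVlt; apply/orP; left; apply/eqP.
  by apply: prod_prob_unique mC => A mA; rewrite !prod_probE// !big_ord0.
rewrite !prod_prob_cons// /distribution /pushforward /=.
set D := (_ @^-1` C); have mD : measurable D.
  by rewrite -[D]setTI; exact: measurable_prod_cons.
set P' := prod_prob (fun i => P (lift ord0 i)); set Q' := prod_prob (fun i => Q (lift ord0 i)).
have PQ' E : measurable E -> (P' E <= (\prod_i c (lift ord0 i))%:E * Q' E)%E.
  by apply: IH => // i A; exact: PQ.
have p0 : 0 <= \prod_i c (lift ord0 i) by apply: prodr_ge0.
have step1 : ((P ord0 \x P') D <= (\prod_i c (lift ord0 i))%:E * (P ord0 \x Q') D)%E.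
  rewrite /product_measure1 -ge0_integralZl//; last exact: measurable_fun_xsection.
  apply: ge0_le_integral => //.
  - exact: measurable_fun_xsection.
  - by apply: measurable_funeM; exact: measurable_fun_xsection.
  - by move=> x _; apply: PQ'; exact: measurable_xsection.
apply: (le_trans step1).
have swap (P0 : probability (Z ord0) R) : ((P0 \x Q') D = (P0 \x^ Q') D)%E.
  by apply: product_measure_unique mD => A B mA mB; exact: product_measure2E.
rewrite big_ord_recl (mulrC (c ord0)) EFinM -muleA lee_wpmul2l//.
rewrite !swap /product_measure2 -ge0_integralZl ?lee_fin//; last exact: measurable_fun_ysection.
apply: ge0_le_integral => //.
- exact: measurable_fun_ysection.
- by apply: measurable_funeM; exact: measurable_fun_ysection.
- by move=> x _; apply: PQ; exact: measurable_ysection.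
Qed.

End product.

(** * Second moments of polynomials in independent variables *)

Section second_moment.
Context {R : realType} (m : nat) (d : 'I_m -> measure_display).
Context (Z : forall i, measurableType (d i)) (P : forall i, probability (Z i) R).
Context (J : finType) (v : J -> forall t, Z t -> R) (A : pred 'I_m) (Gam : J -> J -> R).
Hypothesis v0 : forall j t, A t -> has_integral (P t) (v j (t := t)) 0.
Hypothesis vv : forall j l t, A t ->
  has_integral (P t) (fun z => v j z * v l z) (Gam j l).

(** Monomials in centred independent variables are orthogonal when they involve
    different sets of variables: a coordinate occurring in only one of them
    contributes a factor of mean zero. *)
Lemma monomial_orthogonal (S S' : {set 'I_m}) j l :
  (forall t, t \in S -> A t) -> (forall t, t \in S' -> A t) ->
  has_integral (prod_prob P)
    (fun z => (\prod_(t in S) v j (z t)) * (\prod_(t in S') v l (z t)))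
    (if S == S' then Gam j l ^+ #|S| else 0).
Proof.
move=> SA SA'.
pose g t (z : Z t) := (if t \in S then v j z else 1) * (if t \in S' then v l z else 1).
pose c t := if t \in S then (if t \in S' then Gam j l else 0)
            else (if t \in S' then 0 else 1).
have -> : (if S == S' then Gam j l ^+ #|S| else 0) = \prod_t c t.
  case: eqVneq => [e|SS'].
    rewrite /c -e -prodr_const big_mkcond; apply: eq_bigr => t _.
    by case: (t \in S).
  have [t tS] : exists t, (t \in S) != (t \in S').
    apply/existsP; apply: contraNT SS' => /existsPn H.
    by apply/eqP/setP => t; move: (H t); rewrite negbK => /eqP.
  by rewrite (bigD1 t)//= /c; move: tS; do 2!case: (_ \in _); rewrite ?mul0r.
have gc t : has_integral (P t) (@g t) (c t).
  rewrite /g /c; have [tS|tS] := boolP (t \in S); have [tS'|tS'] := boolP (t \in S').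
  - exact: vv (SA _ tS).
  - by apply: eq_has_integral (v0 j (SA _ tS)) => z; rewrite mulr1.
  - by apply: eq_has_integral (v0 l (SA' _ tS')) => z; rewrite mul1r.
  - by apply: eq_has_integral (has_integral_cst _ 1) => z; rewrite mulr1.
apply: eq_has_integral (has_integral_prod_prob gc) => z.
by rewrite /g big_split /= -!big_mkcond.
Qed.

Lemma has_integral_sum_monomials_sq (I : finType) (Q : pred I) (S : I -> {set 'I_m}) :
  (forall x, Q x -> forall t, t \in S x -> A t) ->
  has_integral (prod_prob P)
    (fun z => (\sum_(x | Q x) \sum_j \prod_(t in S x) v j (z t)) ^+ 2)
    (\sum_(x | Q x) \sum_(y | Q y)
       if S x == S y then \sum_j \sum_l Gam j l ^+ #|S x| else 0).
Proof.
move=> SA.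
have E (z : prodT Z) : (\sum_(x | Q x) \sum_j \prod_(t in S x) v j (z t)) ^+ 2 =
    \sum_(x | Q x) \sum_(y | Q y) \sum_j \sum_l
      (\prod_(t in S x) v j (z t)) * (\prod_(t in S y) v l (z t)).
  rewrite expr2 big_distrlr; apply: eq_bigr => x _; apply: eq_bigr => y _.
  by rewrite big_distrlr.
apply: (eq_has_integral (fun z => esym (E z))).
apply: has_integral_sum => x Qx; apply: has_integral_sum => y Qy.
have -> : (if S x == S y then \sum_j \sum_l Gam j l ^+ #|S x| else 0) =
    \sum_j \sum_l if S x == S y then Gam j l ^+ #|S x| else 0.
  by case: ifP => // _; rewrite big1// => j _; rewrite big1.
apply: has_integral_sum => j _; apply: has_integral_sum => l _.
by apply: monomial_orthogonal; exact: SA.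
Qed.

Section sample.
Context (n : nat) (e : 'I_n -> 'I_m).
Hypotheses (e_inj : injective e) (eA : forall i, A (e i)).

Lemma has_integral_linear_sq :
  has_integral (prod_prob P) (fun z => (\sum_i \sum_j v j (z (e i))) ^+ 2)
    (n%:R * \sum_j \sum_l Gam j l).
Proof.
have SA (i : 'I_n) : predT i -> forall t, t \in [set e i]%SET -> A t.
  by move=> _ t /set1P ->.
have := has_integral_sum_monomials_sq SA.
rewrite (_ : \sum_(x | _) _ = n%:R * \sum_j \sum_l Gam j l); last first.
  rewrite mulr_natl -[in RHS](card_ord n) -sumr_const; apply: eq_bigr => x _.
  rewrite (bigD1 x)//= eqxx cards1 [X in _ + X]big1 ?addr0// => y yx.
  by rewrite (inj_eq set1_inj) (inj_eq e_inj) eq_sym (negbTE yx).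
apply: eq_has_integral => z; congr (_ ^+ 2); apply: eq_bigr => x _.
by apply: eq_bigr => j _; rewrite big_set1.
Qed.

(** Only the pairs (i, k) and (k, i) give the same monomial, whence the factor
    2 in the variance of a degenerate U-statistic. *)
Lemma has_integral_ustat_sq :
  exists2 s, has_integral (prod_prob P)
    (fun z => (\sum_i \sum_(k | k != i) \sum_j v j (z (e i)) * v j (z (e k))) ^+ 2) s &
    s <= n%:R * (n%:R - 1) * 2 * \sum_j \sum_l Gam j l ^+ 2.
Proof.
pose Q (x : 'I_n * 'I_n) := x.2 != x.1.
pose S (x : 'I_n * 'I_n) := [set e x.1; e x.2]%SET.
have SA x : Q x -> forall t, t \in S x -> A t.
  by move=> _ t /set2P[] ->.
have cS x : Q x -> #|S x| = 2%N.
  by move=> Qx; rewrite cards2 (inj_eq e_inj) eq_sym; rewrite (Qx : (x.2 != x.1) = true).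
have pS x (z : prodT Z) j : Q x ->
    \prod_(t in S x) v j (z t) = v j (z (e x.1)) * v j (z (e x.2)).
  by move=> Qx; rewrite big_setU1 ?big_set1//= inE (inj_eq e_inj) eq_sym.
have SS x y : Q x -> Q y -> S x == S y -> (y == x) || (y == (x.2, x.1)).
  case: x y => [i k] [p q] ik pq /eqP/setP E; rewrite !xpair_eqE /=.
  have := E (e p); have := E (e q); rewrite !inE !(inj_eq e_inj) !eqxx ?orbT /=.
  move: ik pq; rewrite /Q /= => ik pq /orP[] /eqP qE /orP[] /eqP pE;
    by move: pq; rewrite pE qE ?eqxx // orbT.
have H := has_integral_sum_monomials_sq SA.
exists (\sum_(x | Q x) \sum_(y | Q y)
   if S x == S y then \sum_j \sum_l Gam j l ^+ #|S x| else 0).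
  apply: eq_has_integral H => z; congr (_ ^+ 2).
  rewrite (pair_big_dep xpredT (fun i k => k != i)) /=; apply: eq_bigr => x Qx.
  by apply: eq_bigr => j _; rewrite pS.
set G := \sum_j \sum_l Gam j l ^+ 2.
have G0 : 0 <= G by apply: sumr_ge0 => j _; apply: sumr_ge0 => l _; exact: sqr_ge0.
have cQ : \sum_(x | Q x) 1 = n%:R * (n%:R - 1) :> R.
  rewrite -(pair_big_dep xpredT (fun i k => k != i) (fun _ _ => 1)) /=.
  rewrite mulr_natl -[in RHS](card_ord n) -sumr_const; apply: eq_bigr => i _.
  rewrite card_ord; have := sumr_const 'I_n (1 : R).
  by rewrite card_ord (bigD1 i)//= => <-; rewrite addrAC subrr add0r.
rewrite -cQ -mulrA mulr_suml; apply: ler_sum => x Qx; rewrite mul1r cS//.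
pose w y := (if y == x then G else 0) + (if y == (x.2, x.1) then G else 0).
have w0 y : 0 <= w y by rewrite /w addr_ge0//; case: ifP.
apply: (@le_trans _ _ (\sum_y w y)).
  rewrite [leLHS]big_mkcond; apply: ler_sum => y _.
  case: ifP => // Qy; case: ifP => // /(SS _ _ Qx Qy); rewrite /w.
  by case: eqP => [->|_] /= => [_|->]; rewrite ?lerDl ?add0r//; case: ifP.
by rewrite big_split /= -!big_mkcond !big_pred1_eq mulr_natl.
Qed.

End sample.
End second_moment.

(** * Lebesgue measure, densities and the Laplace law *)

Section lebesgue.
Context {R : realType}.
Local Notation lambda := (@lebesgue_measure R).

(** A measure on the line is determined by its values on half-open intervals, where
    an affine map acts by scaling lengths. *)
Lemma has_integral_affine (X : R -> R) a b m : a != 0 ->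
  has_integral lambda X m -> has_integral lambda (fun y => `|a| * X (a * y + b)) m.
Proof.
move=> a0 XM; have mX := has_integral_measurable XM.
pose phi : measurableTypeR R -> measurableTypeR R := fun y => a * y + b.
have mphi : measurable_fun setT phi.
  by apply: measurable_funD => //; exact: measurable_funM.
pose phi' : {mfun measurableTypeR R >-> measurableTypeR R} := mfun_Sub (mem_set mphi).
have na0 : 0 < `|a| by rewrite normr_gt0.
have E A : measurable A -> lambda A = (`|a|%:E * lambda (phi @^-1` A))%E.
  pose na : {nonneg R} := NngNum (ltW na0).
  move=> mA; have := @lebesgue_measure_unique R (mscale na (pushforward lambda phi')).
  apply => //= _ [[x y]] _ <-.
  rewrite /mscale /= /pushforward.
  have [agt0|ale0] := ltP 0 a.
    rewrite (_ : _ @^-1` _ = `](x - b) / a, (y - b) / a]%classic); last first.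
      apply/seteqP; split => t /=; rewrite !in_itv/= ltr_pdivrMr// ler_pdivlMr// (mulrC t);
      by rewrite ltrBlDr lerBrDr.
    rewrite !lebesgue_measure_itv/= !lte_fin (ltr_pM2r) ?invr_gt0// ltrD2r.
    case: ifP => _; last by rewrite mule0.
    by rewrite !EFinN -!EFinD -EFinM (gtr0_norm agt0); congr EFin; field; rewrite gt_eqF.
  have alt0 : a < 0 by rewrite lt_neqAle a0.
  rewrite (_ : _ @^-1` _ = `[(y - b) / a, (x - b) / a[%classic); last first.
    apply/seteqP; split => t /=; rewrite !in_itv/= ltr_ndivlMr// ler_ndivrMr// (mulrC t);
    by rewrite ltrBlDr lerBrDr andbC.
  rewrite !lebesgue_measure_itv/= !lte_fin (ltr_nM2r) ?invr_lt0// ltrD2r.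
  case: ifP => _; last by rewrite mule0.
  by rewrite !EFinN -!EFinD -EFinM (ltr0_norm alt0); congr EFin; field; rewrite lt_eqF.
suff : has_integral lambda (fun y => X (phi y) * `|a|) m.
  by apply: eq_has_integral => y; rewrite mulrC.
have [|T _] := @has_integral_transfer _ _ _ _ _ lambda lambda phi (fun=> `|a|) mphi
  (measurable_cst _) (fun=> normr_ge0 a) _ X m mX; last exact: T.
move=> g mg g0; rewrite ge0_integralZr//; last exact: measurableT_comp.
pose na : {nonneg R} := NngNum (ltW na0).
rewrite muleC (_ : (\int[_]_x g (phi x) = \int[pushforward lambda phi']_y g y)%E); last first.
  by rewrite ge0_integral_pushforward.
rewrite -[RHS](@ge0_integral_mscale _ _ _ (pushforward lambda phi') _ measurableT na)//.
by apply: eq_measure_integral => A mA _; exact: E.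
Qed.

End lebesgue.

Section density.
Context {R : realType} (X : set R) (f : density X).
Local Notation lambda := (@lebesgue_measure R).

Lemma density_ext_ge0 x : 0 <= (f \_ X) x.
Proof. by rewrite patchE; case: ifPn => // /set_mem; exact: density_ge0. Qed.

Lemma measurable_density_ext : measurable_fun setT (f \_ X).
Proof. by apply/(measurable_restrictT _ (density_dom f)); exact: density_meas. Qed.

(** The Radon-Nikodym derivative of the law agrees almost everywhere with the
    density, which reduces the change of measure to the known one. *)
Lemma ge0_integral_density_law (g : R -> \bar R) :
  measurable_fun setT g -> (forall y, 0 <= g y)%E ->
  (\int[density_law f]_y g y = \int[lambda]_x (g x * ((f \_ X) x)%:E))%E.
Proof.
move=> mg g0; have lE A : density_law f A = (\int[lambda]_(x in A) ((f \_ X) x)%:E)%E.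
  rewrite /density_law integral_mkcondr.
  by apply: eq_integral => x _; rewrite restrict_EFin.
(* The real line carries two measurable structures with the same measurable
   sets, which are not convertible: the law is pushed by the identity to the
   one on which the Lebesgue measure lives. *)
pose id' : R -> measurableTypeR R := id.
have mid : measurable_fun setT id' by move=> _ A mA; rewrite setTI; exact: mA.
pose toL : {mfun R >-> measurableTypeR R} := mfun_Sub (mem_set mid).
pose nu := distribution (density_law f) toL.
have nuE A : nu A = (\int[lambda]_(x in A) ((f \_ X) x)%:E)%E by exact: lE.
transitivity (\int[nu]_y g y)%E; first by rewrite ge0_integral_distribution.
have dom : nu `<< lambda.
  apply/null_content_dominatesP => A mA A0; rewrite nuE.
  apply: null_set_integral => //.
  by apply/measurable_funTS/measurable_EFinP; exact: measurable_density_ext.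
pose q := Radon_Nikodym_SigmaFinite.f nu lambda.
rewrite -(Radon_Nikodym_SigmaFinite.change_of_variables dom)//.
have iq : lambda.-integrable setT q by exact: Radon_Nikodym_SigmaFinite.f_integrable.
have mq : measurable_fun setT q by case/integrableP : iq.
have mfX : measurable_fun setT (fun x => ((f \_ X) x)%:E).
  by apply/measurable_EFinP; exact: measurable_density_ext.
have qE : ae_eq lambda setT q (fun x => ((f \_ X) x)%:E).
  apply: integral_ae_eq => // A _ mA.
  exact: etrans (esym (Radon_Nikodym_SigmaFinite.f_integral dom mA)) (nuE A).
apply: ae_eq_integral => //.
- exact: emeasurable_funM.
- exact: emeasurable_funM.
- exact: ae_eqe_mul2l.
Qed.

Lemma has_integral_density_law (g : R -> R) m : measurable_fun setT g ->
  has_integral lambda (fun x => g x * (f \_ X) x) m <-> has_integral (density_law f) g m.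
Proof.
pose id' : measurableTypeR R -> R := id.
have mid : measurable_fun setT id' by move=> _ A mA; rewrite setTI; exact: mA.
move=> mg; apply: iff_sym.
have T := @has_integral_transfer _ _ _ _ _ lambda (density_law f) id' (f \_ X) mid.
apply: T => //; [exact: measurable_density_ext|exact: density_ext_ge0|].
exact: ge0_integral_density_law.
Qed.

End density.

Section laplace.
Context {R : realType}.
Local Notation lambda := (@lebesgue_measure R).

Lemma laplaceP (X : R -> R) m : measurable_fun setT X ->
  has_integral (laplace R) X m <-> has_integral lambda (fun x => X x * laplace_pdf x) m.
Proof.
move=> mX; rewrite /laplace -(has_integral_density_law (laplace_density R) m mX).
by rewrite patch_setT.
Qed.

Let F (x : R) : R := - ((x ^+ 2 + 2 * x + 2) * expR (- x)).

Let derive_F (x : R) : is_derive x 1 F (x ^+ 2 * expR (- x)).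
Proof.
rewrite /F; apply: is_derive_eq; rewrite /GRing.scale /= !mulr1; ring.
Qed.

Let cvg_F : F x @[x --> +oo] --> (0 : R).
Proof.
apply/cvgr0Pnorm_lt => e e0; near=> x.
have x1 : 1 <= x by near: x; apply: nbhs_pinfty_ge; exact: num_real.
have xe : 30 / e < x by near: x; apply: nbhs_pinfty_gt; exact: num_real.
have x0 : 0 < x := lt_le_trans ltr01 x1.
have ex : x ^+ 3 / 6 <= expR x.
  by have := expR_ge1Dxn 2 (ltW x0); rewrite (_ : 3`! = 6%N)//; lra.
rewrite /F normrN ger0_norm; last by rewrite mulr_ge0 ?expR_ge0//; nra.
rewrite expRN ltr_pdivrMr ?expR_gt0//.
have {}xe : 30 < x * e by rewrite -ltr_pdivrMr.
apply: lt_le_trans (ler_wpM2l (ltW e0) ex).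
have h1 : x ^+ 2 * 30 < x ^+ 2 * (x * e) by rewrite ltr_pM2l// exprn_gt0.
have h2 : 1 <= x ^+ 2 by rewrite exprn_ege1.
have h3 : x <= x ^+ 2 by rewrite expr2 ler_peMr// ltW.
by lra.
Unshelve. all: by end_near. Qed.

Let integral_half : (\int[lambda]_(x in `[0%R, +oo[) (x ^+ 2 * expR (- x))%:E = 2%:E)%E.
Proof.
have cF : continuous F by move=> x; apply/differentiable_continuous/derivable1_diffP; case: (derive_F x).
rewrite (@ge0_continuous_FTC2y _ _ F 0 0)//.
- by rewrite -EFinB /F oppr0 expR0; congr EFin; ring.
- by move=> x _; rewrite mulr_ge0 ?expR_ge0 ?sqr_ge0.
- apply: continuous_subspaceT; move=> x.
  by apply/differentiable_continuous/derivable1_diffP; exact: ex_derive.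
- exact/cvg_at_right_filter/cF.
- by move=> x _; rewrite derive1E; case: (derive_F x).
Qed.

Let continuous_laplace_pdf : continuous (@laplace_pdf R).
Proof.
move=> x; apply: (@continuousM _ R^o (fun=> 2^-1) (fun w : R => expR (- `|w|))); first exact: cvg_cst.
apply: continuous_comp; last exact: continuous_expR.
by apply: (@continuousN _ R^o); exact: (@norm_continuous _ R^o).
Qed.

Lemma laplace_variance : has_integral (laplace R) (fun x => x ^+ 2) 2.
Proof.
apply: (proj2 (laplaceP _ _)); first exact: measurable_funX.
have mg : measurable_fun setT (fun x : R => x ^+ 2 * laplace_pdf x).
  by apply: measurable_funM => //; exact: density_meas (laplace_density R).
have g0 (x : R) : 0 <= x ^+ 2 * laplace_pdf x.
  by rewrite mulr_ge0 ?sqr_ge0//; exact: density_ge0 (laplace_density R) x I.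
have E : (\int[lambda]_x (x ^+ 2 * laplace_pdf x)%:E = 2%:E)%E.
  rewrite ge0_symfun_integralT//; last by move=> x; rewrite /laplace_pdf /= normrN sqrrN.
  rewrite -set_itvcy (_ : (\int[_]_(x in _) _)%E = ((2^-1)%:E * 2%:E)%E).
    by rewrite -!EFinM mulVf ?mulr1// pnatr_eq0.
  rewrite -integral_half -ge0_integralZl//=.
  - apply: eq_integral => x /set_mem; rewrite /= in_itv/= andbT => x0.
    by rewrite /laplace_pdf ger0_norm// -EFinM; congr EFin; ring.
  - apply/measurable_EFinP; apply: measurable_funTS; apply: measurable_funM => //.
    by apply: measurableT_comp.
  - by move=> x _; rewrite lee_fin mulr_ge0 ?expR_ge0 ?sqr_ge0.
  - move=> x; apply: (@continuousM _ R^o (fun x => x ^+ 2)); first exact: exprn_continuous.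
    exact: continuous_laplace_pdf.
split=> //; apply/integrableP; split; first exact/measurable_EFinP.
rewrite (_ : (\int[_]_x _)%E = 2%:E) ?ltry// -[RHS]E.
by apply: eq_integral => x _; rewrite /= ger0_norm.
Qed.

Lemma laplace_mean : has_integral (laplace R) (fun x => x) 0.
Proof.
have [m mM] : exists m, has_integral (laplace R) (fun x => x) m.
  apply: (has_integral_dom _ _ (has_integralD (has_integral_cst _ 1) laplace_variance)) => // x.
  by have := sqr_ge0 (`|x| - 1); have := sqr_ge0 `|x|; rewrite -(real_normK (num_real x)); lra.
have mM' := (proj1 (laplaceP m (@measurable_id _ _ setT))) mM.
have N0 : -1 != 0 :> R by rewrite oppr_eq0 oner_eq0.
have := has_integralZ (-1) (has_integral_affine 0 N0 mM').
rewrite (_ : (fun y => _) = fun x => x * laplace_pdf x); last first.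
  by apply/funext => x; rewrite /laplace_pdf addr0 (mulN1r x) !normrN normr1; ring.
by move=> /(has_integral_uniq mM') e; rewrite (_ : 0 = m)//; lra.
Qed.

(** The translate by [t] of the Laplace density exceeds it by a factor at most
    [expR `|t|]: the source of all differential privacy here. *)
Lemma laplace_shift (A : set R) (s s' c : R) : measurable A -> 0 < c ->
  (laplace R [set w | A (s + c * w)%R] <=
   (expR (`|s - s'| / c)%R)%:E * laplace R [set w | A (s' + c * w)%R])%E.
Proof.
move=> mA c0; pose t := (s - s') / c.
have mE r : measurable [set w | A (r + c * w)].
  rewrite -[X in measurable X]setTI.
  have mr : measurable_fun setT (fun w : R => r + c * w).
    by apply: measurable_funD => //; exact: measurable_funM.
  exact: mr.
have H r := proj1 (laplaceP _ (measurable_indic (mE r))) (has_integral_indic (laplace R) (mE r)).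
have := has_integral_affine (- t) (oner_neq0 R) (H s).
have := has_integralZ (expR `|t|) (H s').
rewrite -[X in (X <= _)%E]fineK ?fin_num_measure// -[X in (_ <= _ * X)%E]fineK ?fin_num_measure//.
rewrite -EFinM lee_fin.
rewrite (_ : `|s - s'| / c = `|t|); last first.
  by rewrite /t normrM (gtr0_norm (x := c^-1)) ?invr_gt0.
move=> H1 H2; apply: has_integral_le H2 H1 => w.
rewrite normr1 !mul1r !indicE.
rewrite (_ : (w - t \in [set w | A (s + c * w)]) = (w \in [set w | A (s' + c * w)])); last first.
  apply: asbool_equiv_eq => /=; rewrite (_ : s + c * (w - t) = s' + c * w)//.
  by rewrite /t; field; rewrite gt_eqF.
case: (_ \in _); rewrite ?mul0r ?mulr0// !mul1r /laplace_pdf.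
rewrite mulrCA ler_pM2l ?invr_gt0// -expRD ler_expR.
by have := ler_normD (w - t) t; rewrite subrK; lra.
Qed.

End laplace.

(** * Local differential privacy *)

Section sup_norm.
Context {R : realType} (psi : {mfun R >-> R}).
Hypothesis psi_bounded : exists M : R, forall u : R, `|psi u| <= M.

Lemma ler_sup_norm u : `|psi u| <= sup_norm psi.
Proof.
case: psi_bounded => M psiM; apply: sup_upper_bound; last by exists u.
by split; [exists `|psi 0|, 0|exists M => _ [v _ <-]].
Qed.

Lemma sup_norm_ge0 : 0 <= sup_norm psi.
Proof. exact: le_trans (normr_ge0 _) (ler_sup_norm 0). Qed.

Lemma sup_norm_gt0 : (\int[lebesgue_measure]_(u in `[(-1)%R, 1%R]) psi u)%R = 1 ->
  0 < sup_norm psi.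
Proof.
move=> psi1; rewrite lt_neqAle sup_norm_ge0 andbT; apply/eqP => M0.
have psi0 u : psi u = 0.
  by apply/eqP; rewrite -normr_le0 M0; exact: ler_sup_norm.
move: psi1; under eq_Rintegral do rewrite psi0.
by rewrite Rintegral_cst// mul0r => /eqP; rewrite eq_sym oner_eq0.
Qed.

End sup_norm.

Section smooth.
Context {R : realType} (psi : {mfun R >-> R}) (N : nat) (G : grid R N).
Hypothesis psi_bounded : exists M : R, forall u : R, `|psi u| <= M.
Hypothesis h0 : 0 < hw G.
Hypothesis triv : trivIset [set: 'I_N] (cell G).
Local Notation h := (hw G).
Local Notation M := (sup_norm psi).

Lemma measurable_cell j : measurable (cell G j).
Proof. exact: measurable_itv. Qed.

Lemma cells_disjoint j l y : cell G j y -> cell G l y -> j = l.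
Proof. by move=> jy ly; apply: (triv I I); exists y. Qed.

Lemma sum_indic_cell_le1 (y : R) : \sum_j (\1_(cell G j) y : R) <= 1.
Proof.
have [[j jy]|nj] := pselect (exists j, cell G j y).
  rewrite (bigD1 j)//= big1 ?addr0 ?indicE ?mem_set// => l lj.
  by rewrite indicE memNset// => ly; move: lj; rewrite (cells_disjoint jy ly) eqxx.
by rewrite big1// => j _; rewrite indicE memNset// => jy; apply: nj; exists j.
Qed.

Lemma norm_smooth_le j y : `|smooth psi G j y| <= M / h * \1_(cell G j) y.
Proof.
rewrite /smooth !normrM (ger0_norm (x := \1_ _ _)) ?indicE ?ler0n//.
rewrite ler_wpM2r ?ler0n// mulrC normfV (gtr0_norm h0) ler_wpM2r ?invr_ge0 ?(ltW h0)//.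
exact: ler_sup_norm.
Qed.

Lemma smoothM0 j l y : j != l -> smooth psi G j y * smooth psi G l y = 0.
Proof.
move=> jl; rewrite /smooth !indicE.
case: (boolP (y \in cell G j)) => [/set_mem jy|_]; last by rewrite mulr0 mul0r.
rewrite [X in _ * (_ * X)](_ : _ = 0) ?mulr0//.
by rewrite memNset// => ly; move: jl; rewrite (cells_disjoint jy ly) eqxx.
Qed.

Lemma sum_norm_smooth_le y : \sum_j `|smooth psi G j y| <= M / h.
Proof.
have Mh : 0 <= M / h by rewrite divr_ge0 ?sup_norm_ge0 ?ltW.
apply: (@le_trans _ _ (\sum_j M / h * \1_(cell G j) y)).
  by apply: ler_sum => j _; exact: norm_smooth_le.
by rewrite -mulr_sumr ler_piMr// sum_indic_cell_le1.
Qed.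

End smooth.

Section privacy.
Context {R : realType} (alpha : R) (psi : {mfun R >-> R}) (N : nat) (G : grid R N).
Hypothesis psi_bounded : exists M : R, forall u : R, `|psi u| <= M.
Hypothesis M0 : 0 < sup_norm psi.
Hypothesis h0 : 0 < hw G.
Hypothesis alpha01 : 0 < alpha < 1.
Hypothesis triv : trivIset [set: 'I_N] (cell G).
Local Notation h := (hw G).
Local Notation M := (sup_norm psi).
Local Notation sigma := (2 * M / (alpha * h)).

Let alpha0 : 0 < alpha. Proof. by case/andP: alpha01. Qed.

Lemma noise_scale_gt0 : 0 < sigma.
Proof. by rewrite divr_gt0 ?mulr_gt0. Qed.

Let measurable_shift s : measurable_fun setT (fun w : R => s + sigma * w).
Proof. by apply: measurable_funD => //; exact: measurable_funM. Qed.

Definition noisy_coord s : {mfun R >-> R} := mfun_Sub (mem_set (measurable_shift s)).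

Lemma smooth_kernelE x A : measurable A ->
  smooth_kernel alpha psi G x A =
  prod_prob (fun j => distribution (laplace R) (noisy_coord (smooth psi G j x))) A.
Proof.
move=> mA; have mn : measurable_fun setT (fun w => noisy alpha psi G (x, w)).
  exact: (measurableT_comp (measurable_noisy alpha psi G) (pair1_measurable x)).
pose nx := mfun_Sub (mem_set mn) : {mfun prodT (fun _ : 'I_N => R) >-> prodT (fun _ : 'I_N => R)}.
transitivity (distribution (prod_prob (fun _ => laplace R)) nx A).
  by rewrite /smooth_kernel randomizeE.
apply: prod_prob_unique mA => B mB; rewrite prod_probE//.
rewrite /distribution /pushforward /= -prod_probE// => j.
by rewrite -[X in measurable X]setTI; exact: (measurable_shift (smooth psi G j x)).
Qed.

(** Moving the data point changes at most two coordinates of the smoothed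
    vector, each by at most [M / h], which is what the noise scale
    [2 M / (alpha h)] is calibrated for. *)
Lemma ldp_smooth_kernel (X : set R) : ldp X alpha (smooth_kernel alpha psi G).
Proof.
move=> A x x' mA _ _; rewrite !smooth_kernelE//.
pose c j := expR (`|smooth psi G j x - smooth psi G j x'| / sigma).
apply: (@le_trans _ _ ((\prod_j c j)%:E * prod_prob (fun j =>
    distribution (laplace R) (noisy_coord (smooth psi G j x'))) A)%E).
  apply: prod_prob_dominated => //; last by move=> j; exact: expR_ge0.
  by move=> j B mB; apply: laplace_shift => //; exact: noise_scale_gt0.
rewrite lee_wpmul2r// lee_fin -expR_sum ler_expR -mulr_suml.
rewrite ler_pdivrMr ?noise_scale_gt0//.
apply: (@le_trans _ _ (M / h + M / h)); last first.
  by rewrite le_eqVlt; apply/orP; left; apply/eqP; field; rewrite !gt_eqF.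
apply: (@le_trans _ _ (\sum_j (`|smooth psi G j x| + `|smooth psi G j x'|))).
  by apply: ler_sum => j _; exact: ler_normB.
by rewrite big_split lerD// sum_norm_smooth_le.
Qed.

Lemma c_alpha_gt1 : 1 < c_alpha alpha.
Proof.
have e1 : 1 < expR alpha by rewrite expR_gt1.
by rewrite /c_alpha ltr_pdivlMr ?subr_gt0// mul1r; lra.
Qed.

Lemma out_prob01 x : 0 <= out_prob alpha G x <= 1.
Proof.
have c1 := c_alpha_gt1; have c0 : 0 < c_alpha alpha by lra.
have : 0 <= (\1_(~` \bigcup_j closed_cell G j) x : R) / c_alpha alpha <= 1.
  apply/andP; split; first by rewrite divr_ge0 ?indicE// ltW.
  by rewrite ler_pdivrMr// mul1r indicE; case: (_ \in _) => /=; lra.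
rewrite /out_prob; lra.
Qed.

Lemma sign_kernelE x A : measurable A ->
  sign_kernel alpha G x A =
  (out_prob alpha G x * \1_A (c_alpha alpha) +
   (1 - out_prob alpha G x) * \1_A (- c_alpha alpha))%:E.
Proof.
move=> mA; rewrite /sign_kernel randomizeE// /= bernoulli_probE ?out_prob01//.
Qed.

(** The two possible probabilities of the sign are [1/2] and
    [r = expR alpha / (expR alpha + 1)]; the choice of [c_alpha] makes
    [expR alpha * (1 - r) = r], from which all comparisons follow. *)
Lemma ldp_sign_kernel (X : set R) : ldp X alpha (sign_kernel alpha G).
Proof.
move=> A x x' mA _ _; rewrite !sign_kernelE// -EFinM lee_fin.
have e1 : 1 < expR alpha by rewrite expR_gt1.
pose r := expR alpha / (expR alpha + 1).
have pE y : out_prob alpha G y = if y \in ~` \bigcup_j closed_cell G j then r else 2^-1.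
  rewrite /out_prob /c_alpha indicE; case: ifP => _ /=; last by rewrite mul0r addr0 mulr1.
  by rewrite /r; field; rewrite !gt_eqF//; lra.
have er : expR alpha * (1 - r) = r by rewrite /r; field; rewrite gt_eqF//; lra.
have r1 : 2^-1 <= r by rewrite /r ler_pdivlMr; lra.
have r2 : r <= 1 by rewrite /r ler_pdivrMr; lra.
have r3 : r <= expR alpha * 2^-1 by nra.
have a0 : 0 <= (\1_A (c_alpha alpha) : R) by rewrite indicE.
have b0 : 0 <= (\1_A (- c_alpha alpha) : R) by rewrite indicE.
have : out_prob alpha G x <= expR alpha * out_prob alpha G x'.
  by rewrite !pE; case: ifP => _; case: ifP => _; nra.
have : 1 - out_prob alpha G x <= expR alpha * (1 - out_prob alpha G x').
  by rewrite !pE; case: ifP => _; case: ifP => _; nra.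
move: (out_prob alpha G x) (out_prob alpha G x') => p q H1 H2.
by rewrite mulrDr !mulrA lerD// ler_wpM2r.
Qed.

Lemma ldp_mechanism (X : set R) n i : ldp X alpha (@mechanism R alpha psi N G n i).
Proof.
rewrite /mechanism; case: (i < n)%N; first exact: ldp_smooth_kernel.
exact: ldp_sign_kernel.
Qed.

End privacy.

(** * Moments of the privatised observations *)

Section outputs.
Context {R : realType} (alpha : R) (psi : {mfun R >-> R}) (N : nat) (G : grid R N).
Context (X : set R) (f : density X).
Local Notation sigma := (2 * sup_norm psi / (alpha * hw G)).
Local Notation noise := (prod_prob (fun _ : 'I_N => laplace R)).

Lemma noise_mean j : has_integral noise (fun w => w j) 0.
Proof.
have := @monomial_orthogonal R N _ _ (fun _ : 'I_N => laplace R) unit (fun _ _ w => w) predT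
  (fun _ _ => 2) (fun _ _ _ => laplace_mean) (fun _ _ _ _ => laplace_variance) [set j]%SET finset.set0
  tt tt (fun _ _ => isT) (fun _ _ => isT).
rewrite (_ : ([set j]%SET == finset.set0) = false); last by apply/negbTE/set0Pn; exists j; rewrite inE.
by apply: eq_has_integral => w; rewrite big_set1 big_set0 mulr1.
Qed.

Lemma noise_covariance j l :
  has_integral noise (fun w => w j * w l) (if j == l then 2 else 0).
Proof.
have := @monomial_orthogonal R N _ _ (fun _ : 'I_N => laplace R) unit (fun _ _ w => w) predT
  (fun _ _ => 2) (fun _ _ _ => laplace_mean) (fun _ _ _ _ => laplace_variance) [set j]%SET
  [set l]%SET tt tt (fun _ _ => isT) (fun _ _ => isT).
rewrite (inj_eq set1_inj) cards1 expr1.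
by apply: eq_has_integral => w; rewrite !big_set1.
Qed.

HB.instance Definition _ := isMeasurableFun.Build _ _ _ _ (noisy alpha psi G)
  (measurable_noisy alpha psi G).

Lemma has_integral_marginal_smooth (Y : prodT (fun _ : 'I_N => R) -> R) m :
  measurable_fun setT Y ->
  has_integral (density_law f \x noise)%E (fun p => Y (noisy alpha psi G p)) m ->
  has_integral (marginal f (smooth_kernel alpha psi G)) Y m.
Proof.
move=> mY YM.
have E A : measurable A -> distribution (density_law f \x noise)%E (noisy alpha psi G) A =
    marginal f (smooth_kernel alpha psi G) A.
  move=> mA; rewrite /marginal /distribution /pushforward /= /product_measure1.
  apply: eq_integral => x _; rewrite /smooth_kernel randomizeE//=; congr (_ _).
  by apply/seteqP; split => w /=; rewrite /xsection/= inE.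
apply: (eq_has_integral_measure E).
by apply/has_integral_distribution.
Qed.

Lemma marginal_coord_mean j m : has_integral (density_law f) (smooth psi G j) m ->
  has_integral (marginal f (smooth_kernel alpha psi G)) (fun z => z j - m) 0.
Proof.
move=> sm; apply: has_integral_marginal_smooth.
  by apply: measurable_funB => //; exact: (@measurable_coord _ _ (fun=> R)).
have sm' := has_integralD sm (has_integral_cst (density_law f) (- m)).
have H1 := has_integral_prod sm' (has_integral_cst noise 1).
have H2 := has_integral_prod (has_integral_cst (density_law f) sigma) (noise_mean j).
have := has_integralD H1 H2; rewrite subrr mul0r mulr0 addr0.
by apply: eq_has_integral => p; rewrite /noisy; ring.
Qed.

Lemma marginal_coord_covariance (m : 'I_N -> R) j l k :
  (forall j, has_integral (density_law f) (smooth psi G j) (m j)) ->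
  has_integral (density_law f) (fun y => smooth psi G j y * smooth psi G l y) k ->
  has_integral (marginal f (smooth_kernel alpha psi G)) (fun z => (z j - m j) * (z l - m l))
    (k - m j * m l + sigma ^+ 2 * (if j == l then 2 else 0)).
Proof.
move=> sm sk; apply: has_integral_marginal_smooth.
  by apply: measurable_funM; apply: measurable_funB => //; exact: (@measurable_coord _ _ (fun=> R)).
have c1 := has_integral_cst (density_law f).
have skc := has_integralD sk (has_integralD (has_integralZ (- m l) (sm j))
  (has_integralD (has_integralZ (- m j) (sm l)) (c1 (m j * m l)))).
have sj := has_integralD (sm j) (c1 (- m j)); have sl := has_integralD (sm l) (c1 (- m l)).
have H1 := has_integral_prod skc (has_integral_cst noise 1).
have H2 := has_integral_prod sj (has_integralZ sigma (noise_mean l)).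
have H3 := has_integral_prod sl (has_integralZ sigma (noise_mean j)).
have H4 := has_integral_prod (c1 (sigma ^+ 2)) (noise_covariance j l).
have := has_integralD H1 (has_integralD H2 (has_integralD H3 H4)).
rewrite [X in has_integral _ _ X -> _](_ : _ =
  k - m j * m l + sigma ^+ 2 * (if j == l then 2 else 0)); last by ring.
by apply: eq_has_integral => p; rewrite /noisy; ring.
Qed.

(** Unconditionally the output is a two-valued variable, whose parameter is the
    mean of the conditional one. *)
Lemma has_integral_marginal_sign (p : R) (Y : R -> R) : 0 < alpha < 1 ->
  measurable_fun setT Y ->
  has_integral (density_law f) (out_prob alpha G) p ->
  has_integral (marginal f (sign_kernel alpha G)) Y
    (p * Y (c_alpha alpha) + (1 - p) * Y (- c_alpha alpha)).
Proof.
move=> a01 mY op.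
have p01 : 0 <= p <= 1.
  rewrite (has_integral_ge0 _ op) => [|x]; last by case/andP: (out_prob01 G a01 x).
  by apply: has_integral_le op (has_integral_cst _ 1) => x; case/andP: (out_prob01 G a01 x).
pose s b : R := if b then c_alpha alpha else - c_alpha alpha.
have ms : measurable_fun setT s by [].
pose S : {mfun bool >-> R} := mfun_Sub (mem_set ms).
have E A : measurable A -> distribution (bernoulli_prob p) S A =
    marginal f (sign_kernel alpha G) A.
  move=> mA; rewrite /marginal /distribution /pushforward /= bernoulli_probE//.
  under eq_integral do rewrite sign_kernelE//.
  set a := \1_A (c_alpha alpha); set b := \1_A (- c_alpha alpha).
  have op' := has_integralD (has_integral_cst _ 1) (has_integralZ (-1) op).
  have [_] := has_integralD (has_integralZ a op) (has_integralZ b op').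
  rewrite [X in _ = X -> _](_ : _ = (p * a + (1 - p) * b)%:E); last by congr EFin; ring.
  move=> e; transitivity ((p * a + (1 - p) * b)%:E); first by rewrite !diracE -!EFinM -EFinD.
  by rewrite -e; apply: eq_integral => x _; congr EFin; ring.
apply: (eq_has_integral_measure E).
apply/has_integral_distribution => //.
have pt : bernoulli_prob p [set true] = p%:E.
  by rewrite bernoulli_probE// !diracE mem_set// memNset//= mule1 mule0 adde0.
have hi : has_integral (bernoulli_prob p) (\1_[set true]) p.
  rewrite -[X in has_integral _ _ X]/(fine p%:E) -pt.
  exact: (has_integral_indic (bernoulli_prob p)).
have := has_integralD (has_integral_cst (bernoulli_prob p) (Y (- c_alpha alpha)))
  (has_integralZ (Y (c_alpha alpha) - Y (- c_alpha alpha)) hi).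
rewrite [X in has_integral _ _ X -> _](_ : _ =
  p * Y (c_alpha alpha) + (1 - p) * Y (- c_alpha alpha)); last by ring.
apply: eq_has_integral => b; rewrite indicE (_ : S b = s b)// /s.
by case: b; [rewrite mem_set|rewrite memNset]; rewrite //=; ring.
Qed.

End outputs.

(** * Measurability of the test *)

Lemma measurable_sum_cond {R : realType} {d} {T : measurableType d} (I : finType) (P : pred I)
    (F : I -> T -> R) : (forall i, measurable_fun setT (F i)) ->
  measurable_fun setT (fun x => \sum_(i | P i) F i x).
Proof.
move=> mF; under eq_fun do rewrite big_mkcond.
by apply: measurable_sum => i; case: (P i).
Qed.

Section measurable_test.
Context {R : realType} (N n : nat).

Lemma measurable_out_vec first j : measurable_fun setT (fun z : out R N first => out_vec z j).
Proof. by case: first; [exact: (@measurable_coord _ _ (fun=> R))|exact: measurable_cst]. Qed.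

Lemma measurable_out_real first : measurable_fun setT (fun z : out R N first => out_real z).
Proof. by case: first; [exact: measurable_cst|exact: measurable_id]. Qed.

Lemma measurable_Zvec i j : measurable_fun setT (fun z : sample R N n => Zvec z i j).
Proof.
exact: (measurableT_comp (measurable_out_vec j)
  (@measurable_coord _ _ (fun i : 'I_(n + n) => out R N (i < n)%N) (lshift n i))).
Qed.

Lemma measurable_Zreal i : measurable_fun setT (fun z : sample R N n => Zreal z i).
Proof.
exact: (measurableT_comp (@measurable_out_real _)
  (@measurable_coord _ _ (fun i : 'I_(n + n) => out R N (i < n)%N) (rshift n i))).
Qed.

Lemma measurable_S_stat (G : grid R N) f0 :
  measurable_fun setT (S_stat G f0 : sample R N n -> R).
Proof.
apply: measurable_sum => j; apply: measurable_funM => //.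
apply: measurable_sum => i; apply: measurable_sum_cond => k.
by apply: measurable_funM; apply: measurable_funB => //; exact: measurable_Zvec.
Qed.

Lemma measurable_T_stat X B f0 : measurable_fun setT (T_stat X B f0 : sample R N n -> R).
Proof.
apply: measurable_funB => //; apply: measurable_funM => //.
by apply: measurable_sum => i; exact: measurable_Zreal.
Qed.

Lemma measurable_Phi X (G : grid R N) B f0 t1 t2 :
  measurable_fun setT (Phi X G B f0 t1 t2 : sample R N n -> bool).
Proof.
apply: measurable_or; apply: measurable_fun_ler => //.
  exact: measurable_S_stat.
exact: measurable_T_stat.
Qed.

End measurable_test.

(** * Bias of the kernel *)

Section cell_bounds.
Context {R : realType} (N : nat) (G : grid R N).

Lemma interior_cell j y : ctr G j - hw G < y < ctr G j + hw G -> cell G j y.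
Proof. by move=> /andP[y1 y2]; rewrite /cell /= in_itv /= !lteifS. Qed.

Lemma cell_closed j y : cell G j y -> ctr G j - hw G <= y <= ctr G j + hw G.
Proof. by rewrite /cell /= in_itv /= => /andP[/lteifW -> /lteifW ->]. Qed.

End cell_bounds.

Section rescaling.
Context {R : realType} (N : nat) (G : grid R N).
Hypothesis h0 : 0 < hw G.
Local Notation h := (hw G).
Local Notation lambda := (@lebesgue_measure R).

Lemma has_integral_window : has_integral lambda (\1_`[(-1 : R), 1]) 2.
Proof.
have m2 : lambda `[(-1 : R), 1] = 2%:E.
  rewrite lebesgue_measure_itv/= lte_fin ifT; last by lra.
  by rewrite -EFinD; congr EFin; lra.
by apply: has_integral_indic_measure => //; exact: measurable_itv.
Qed.

Lemma has_integral_window_mul (q : R -> R) K : measurable_fun setT q ->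
  (forall u, ~ (-1 <= u <= 1) -> q u = 0) -> (forall u, -1 <= u <= 1 -> `|q u| <= K) ->
  has_integral lambda q (\int[lambda]_(u in `[(-1)%R, 1%R]) q u)%R.
Proof.
move=> mq q0 qK.
have [u|m qm] := @has_integral_dom _ _ _ lambda q _ _ mq _ (has_integralZ K has_integral_window).
  rewrite indicE; case: (boolP (u \in _)) => [/set_mem/= |/negP u1]; rewrite ?in_itv/=.
    by rewrite mulr1; exact: qK.
  by rewrite q0 ?normr0 ?mulr0// => u2; apply: u1; rewrite inE/= in_itv.
suff -> : (\int[lambda]_(u in `[(-1)%R, 1%R]) q u)%R = m by [].
rewrite Rintegral_mkcond /Rintegral.
have -> : q \_ `[(-1)%R, 1%R] = q.
  apply/funext => u; rewrite patchE; case: ifPn => // /negP u1.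
  by rewrite q0// => u2; apply: u1; rewrite inE/= in_itv.
by case: qm => _ ->.
Qed.

(** Rescaling to a cell: only the end points, a null set, distinguish the cell
    from the support of the rescaled function. *)
Lemma has_integral_cell (q : R -> R) m j :
  (forall u, ~ (-1 <= u <= 1) -> q u = 0) -> has_integral lambda q m ->
  has_integral lambda (fun y => h^-1 * q ((ctr G j - y) / h) * \1_(cell G j) y) m.
Proof.
move=> q0 qm; have mq := has_integral_measurable qm.
have a0 : - h^-1 != 0 by rewrite oppr_eq0 invr_eq0 gt_eqF.
have := has_integral_affine (ctr G j / h) a0 qm.
pose E := [set ctr G j - h] `|` [set ctr G j + h].
apply: (@eq_has_integral_ae _ _ _ lambda E).
- by apply: measurableU; exact: measurable_set1.
- by apply: null_set_setU; (exact: measurable_set1 || exact: lebesgue_measure_set1).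
- apply: measurable_funM; last by apply: measurable_indic; exact: measurable_itv.
  apply: measurable_funM => //; apply: measurableT_comp => //.
  by apply: measurable_funM => //; exact: measurable_funB.
move=> y nE; rewrite normrN gtr0_norm ?invr_gt0//.
rewrite (_ : - h^-1 * y + ctr G j / h = (ctr G j - y) / h); last by ring.
have [yin|yout] := boolP (ctr G j - h < y < ctr G j + h).
  by rewrite indicE mem_set ?mulr1//; exact: interior_cell.
rewrite q0 ?mulr0 ?mul0r// => /andP[u1 u2]; apply: nE.
move: u1 u2; rewrite ler_pdivlMr// ler_pdivrMr// => u1 u2.
have /orP[/eqP e|/eqP e] : (y == ctr G j - h) || (y == ctr G j + h).
    apply: contraR yout; rewrite negb_or !neq_lt => /andP[H1 H2]; apply/andP; split.
      case/orP: H1 => //; lra.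
    case/orP: H2 => //; lra.
  by left; exact: e.
by right; exact: e.
Qed.

End rescaling.

Section bias.
Context {R : realType} (psi : {mfun R >-> R}) (N : nat) (G : grid R N).
Hypothesis psi_bounded : exists M : R, forall u : R, `|psi u| <= M.
Hypothesis psi_support : forall u : R, ~ (-1 <= u <= 1) -> psi u = 0.
Hypothesis psi_int : (\int[lebesgue_measure]_(u in `[(-1)%R, 1%R]) psi u)%R = 1.
Context (X B : set R) (beta : R).
Hypothesis BX : B `<=` X.
Hypothesis GB : grid_partition G B.
Hypothesis beta01 : 0 < beta <= 1.
Local Notation h := (hw G).
Local Notation M := (sup_norm psi).
Local Notation lambda := (@lebesgue_measure R).

Lemma hw_gt0 : 0 < h. Proof. by case: GB. Qed.

Lemma trivIset_cell : trivIset [set: 'I_N] (cell G). Proof. by case: GB. Qed.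

Lemma cell_subset j y : cell G j y -> B y.
Proof. by case: GB => _ _ -> _ jy; exists j. Qed.

Lemma ctr_subset j : B (ctr G j).
Proof. by apply/cell_subset/interior_cell; have := hw_gt0; lra. Qed.

Lemma has_integral_psi : has_integral lambda psi 1.
Proof.
rewrite -psi_int; apply: (has_integral_window_mul (K := M)) => // u _.
exact: ler_sup_norm.
Qed.

Lemma powR_le1 (u : R) : 0 <= u <= 1 -> u `^ beta <= 1.
Proof.
move=> /andP[u0 u1]; rewrite (_ : 1 = 1 `^ beta); last by rewrite powR1.
apply: ge0_ler_powR; rewrite ?nnegrE//.
by case/andP: beta01 => /ltW.
Qed.

Lemma has_integral_C_beta :
  has_integral lambda (fun u => `|u| `^ beta * `|psi u|) (C_beta beta psi).
Proof.
apply: (has_integral_window_mul (K := M)).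
- apply: measurable_funM; last exact: measurableT_comp.
  by apply: (measurableT_comp (measurable_powR beta)); exact: normr_measurable.
- by move=> u /psi_support ->; rewrite normr0 mulr0.
move=> u u1; rewrite ger0_norm ?mulr_ge0 ?powR_ge0//.
have := ler_sup_norm psi_bounded u; have : `|u| `^ beta <= 1.
  by apply: powR_le1; rewrite normr_ge0 ler_norml.
by have := powR_ge0 `|u| beta; have := normr_ge0 (psi u); nra.
Qed.

Lemma C_beta_ge0 : 0 <= C_beta beta psi.
Proof. by apply: has_integral_ge0 has_integral_C_beta => u; rewrite mulr_ge0 ?powR_ge0. Qed.

Lemma C_beta_le : C_beta beta psi <= 2 * M.
Proof.
rewrite [leRHS]mulrC; apply: has_integral_le has_integral_C_beta
  (has_integralZ M has_integral_window) => u.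
rewrite indicE; case: (boolP (u \in _)) => [/set_mem/= | /negP u1].
  rewrite in_itv/= mulr1 => u1.
  have := ler_sup_norm psi_bounded u; have : `|u| `^ beta <= 1.
    by apply: powR_le1; rewrite normr_ge0 ler_norml.
  by have := powR_ge0 `|u| beta; have := normr_ge0 (psi u); nra.
rewrite psi_support ?normr0 ?mulr0// => u2; apply: u1.
by rewrite inE/= in_itv.
Qed.

Section density.
Context (L : R) (f : density X).
Hypothesis fH : holder X beta L f.

(** The kernel averages [f] over a cell of half-width [h], where [f] varies by
    at most [L h^beta] around its value at the centre. *)
Lemma smooth_bias j m : has_integral (density_law f) (smooth psi G j) m ->
  `|m - f (ctr G j)| <= L * h `^ beta * C_beta beta psi.
Proof.
have h0 := hw_gt0.
have sm1 := has_integral_cell h0 j psi_support has_integral_psi.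
move/(has_integral_density_law _ _ (measurable_smooth psi G j)) => sm.
have [c Hc] := has_integral_norm (has_integralD sm (has_integralZ (- f (ctr G j)) sm1)).
rewrite mulr1 => mc; apply: (le_trans mc).
have q0 u : ~ (-1 <= u <= 1) -> `|u| `^ beta * `|psi u| = 0.
  by move=> /psi_support ->; rewrite normr0 mulr0.
have HC := has_integralZ (L * h `^ beta) (has_integral_cell h0 j q0 has_integral_C_beta).
apply: has_integral_le Hc HC => y; rewrite /smooth.
have [jy|njy] := pselect (cell G j y); last first.
  have z : (\1_(cell G j) y : R) = 0 by rewrite indicE memNset.
  by rewrite z !mulr0 mul0r addr0 normr0.
have By := cell_subset jy.
rewrite indicE mem_set// !mulr1 patchE mem_set; last exact: BX.
rewrite (_ : _ + _ = h^-1 * psi ((ctr G j - y) / h) * (f y - f (ctr G j))); last by ring.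
have hV : `|h^-1| = h^-1 by rewrite ger0_norm ?invr_ge0 ?ltW.
have fL := fH (BX By) (BX (ctr_subset j)).
have -> : L * h `^ beta * (h^-1 * (`|(ctr G j - y) / h| `^ beta * `|psi ((ctr G j - y) / h)|)) =
    h^-1 * `|psi ((ctr G j - y) / h)| * (L * `|y - ctr G j| `^ beta).
  rewrite (_ : `|y - ctr G j| = h * `|(ctr G j - y) / h|); last first.
    by rewrite normrM hV mulrCA mulfV ?gt_eqF// mulr1 distrC.
  by rewrite powRM ?normr_ge0 ?(ltW h0)//; ring.
rewrite 2!normrM hV ler_wpM2l//.
by rewrite mulr_ge0 ?normr_ge0 ?invr_ge0 ?(ltW h0).
Qed.

End density.
End bias.

(** * The partition and the L1 distance *)

Section partition.
Context {R : realType} (N : nat) (G : grid R N) (X B : set R).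
Hypothesis BX : B `<=` X.
Hypothesis GB : grid_partition G B.
Local Notation h := (hw G).
Local Notation lambda := (@lebesgue_measure R).

Let h0 : 0 < h := hw_gt0 GB.

Lemma measurable_partition : measurable B.
Proof.
have [_ _ -> _] := GB; apply: fin_bigcup_measurable => // j _; exact: measurable_cell.
Qed.

Lemma sum_indic_cell y : \sum_j (\1_(cell G j) y : R) = \1_B y.
Proof.
have [By|nBy] := pselect (B y); last first.
  rewrite [RHS]indicE memNset// big1// => j _; rewrite indicE memNset// => jy.
  exact/nBy/(cell_subset GB jy).
have [j jy] : exists j, cell G j y.
  by move: By; have [_ _ -> _] := GB => -[j _ jy]; exists j.
rewrite [RHS]indicE mem_set// (bigD1 j)//= [X in _ + X]big1 ?addr0 ?indicE ?mem_set// => l lj.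
rewrite indicE memNset// => ly; move: lj.
by rewrite (cells_disjoint (trivIset_cell GB) jy ly) eqxx.
Qed.

Lemma has_integral_indic_cell j : has_integral lambda (\1_(cell G j)) (2 * h).
Proof.
have m2 : lambda (cell G j) = (2 * h)%:E.
  rewrite /cell lebesgue_measure_itv/= lte_fin ifT; last by have := h0; lra.
  by rewrite -EFinD; congr EFin; ring.
by apply: has_integral_indic_measure => //; exact: measurable_cell.
Qed.

Lemma vol_grid : vol B = 2 * N%:R * h.
Proof.
have H := has_integral_sum (index_enum 'I_N) (P := xpredT) (fun j _ => has_integral_indic_cell j).
have {H}[_] := @eq_has_integral _ _ _ lambda _ (\1_B) _ sum_indic_cell H.
rewrite integral_indic// ?setIT; last exact: measurable_partition.
by rewrite /vol => -> /=; rewrite sumr_const card_ord -mulr_natl; ring.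
Qed.

Lemma has_integral_outside (f : density X) :
  has_integral (density_law f) (\1_(~` B)) (\int[lambda]_(x in X `\` B) f x)%R.
Proof.
have mB := measurable_partition.
have [m fm] := has_integral_bounded (density_law f) (measurable_indic (measurableC mB))
  (M := 1) (fun x => ltac:(by rewrite indicE; case: (_ \in _) => /=; rewrite ?normr1 ?normr0)).
suff -> : (\int[lambda]_(x in X `\` B) f x)%R = m by [].
move: fm => /(has_integral_density_law _ _ (measurable_indic (measurableC mB)))[_ e].
rewrite /Rintegral integral_mkcond -[RHS]/(fine m%:E) -e; congr fine.
apply: eq_integral => x _; rewrite restrict_EFin; congr EFin.
rewrite indicE !patchE in_setD in_setC.
by case: (x \in X); case: (x \in B); rewrite /= ?mulr0 ?mul0r ?mul1r.
Qed.

Section holder.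
Context (beta L : R) (f f0 : density X).
Hypothesis beta01 : 0 < beta <= 1.
Hypothesis L0 : 0 <= L.
Hypotheses (fH : holder X beta L f) (f0H : holder X beta L f0).
Local Notation delta j := (f (ctr G j) - f0 (ctr G j)).

Lemma holder_cell (g : R -> R) j y : holder X beta L g -> cell G j y ->
  `|g y - g (ctr G j)| <= L * h `^ beta.
Proof.
move=> gH jy; apply: le_trans (gH _ _ (BX (cell_subset GB jy)) (BX (ctr_subset GB j))) _.
rewrite ler_wpM2l//; apply: ge0_ler_powR; rewrite ?nnegrE ?(ltW h0)//.
  by apply: ltW; case/andP: beta01.
by have := cell_closed jy; rewrite ler_norml; lra.
Qed.

(** On [B] the L1 distance is controlled by the values at the centres, outside
    by the masses of the two densities. *)
Lemma l1_dist_le :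
  (l1_dist X f f0 <= (\sum_j (`|delta j| + 2 * (L * h `^ beta)) * (2 * h) +
    ((\int[lambda]_(x in X `\` B) f x)%R + (\int[lambda]_(x in X `\` B) f0 x)%R))%:E)%E.
Proof.
have mB := measurable_partition.
have out (g : density X) := proj2 (has_integral_density_law _ _
  (measurable_indic (measurableC mB))) (has_integral_outside g).
have H : has_integral lambda
    (fun y => \sum_j (`|delta j| + 2 * (L * h `^ beta)) * \1_(cell G j) y +
      (\1_(~` B) y * (f \_ X) y + \1_(~` B) y * (f0 \_ X) y))
    (\sum_j (`|delta j| + 2 * (L * h `^ beta)) * (2 * h) +
    ((\int[lambda]_(x in X `\` B) f x)%R + (\int[lambda]_(x in X `\` B) f0 x)%R)).
  apply: has_integralD; last by apply: has_integralD; exact: out.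
  by apply: has_integral_sum => j _; apply: has_integralZ; exact: has_integral_indic_cell.
have dom y : `|(f \_ X) y - (f0 \_ X) y| <=
    \sum_j (`|delta j| + 2 * (L * h `^ beta)) * \1_(cell G j) y +
      (\1_(~` B) y * (f \_ X) y + \1_(~` B) y * (f0 \_ X) y).
  have c0 j : 0 <= `|delta j| + 2 * (L * h `^ beta).
    by rewrite addr_ge0 ?normr_ge0 ?mulr_ge0 ?powR_ge0.
  have [By|nBy] := pselect (B y); last first.
    rewrite big1 ?add0r => [|j _]; last first.
      by rewrite indicE memNset ?mulr0// => jy; exact/nBy/(cell_subset GB jy).
    rewrite indicE mem_set// !mul1r; apply: le_trans (ler_normB _ _) _.
    by rewrite !ger0_norm ?density_ext_ge0.
  have [j jy] : exists j, cell G j y.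
    by move: By; have [_ _ -> _] := GB => -[j _ jy]; exists j.
  rewrite (_ : (\1_(~` B) y : R) = 0); last by rewrite indicE memNset//=; exact.
  rewrite !mul0r !addr0 (bigD1 j)//= -[leLHS]addr0; apply: lerD; last first.
    by apply: sumr_ge0 => l _; rewrite mulr_ge0// indicE.
  rewrite indicE mem_set// mulr1 !patchE mem_set; last exact: BX.
  have := holder_cell fH jy; have := holder_cell f0H jy.
  rewrite (_ : f y - f0 y = (f y - f (ctr G j)) + delta j - (f0 y - f0 (ctr G j))); last by ring.
  have := ler_normB (f y - f (ctr G j) + delta j) (f0 y - f0 (ctr G j)).
  by have := ler_normD (f y - f (ctr G j)) (delta j); lra.
have mD : measurable_fun setT (fun y => `|(f \_ X) y - (f0 \_ X) y|).
  apply: measurableT_comp => //.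
  by apply: measurable_funB; exact: measurable_density_ext.
have [y|m Hm] := @has_integral_dom _ _ _ lambda _ _ _ mD _ H; first by rewrite normr_id.
have -> : l1_dist X f f0 = m%:E.
  case: Hm => _ <-; rewrite /l1_dist [LHS]integral_mkcond; apply: eq_integral => x _.
  rewrite restrict_EFin; congr EFin; rewrite !patchE; case: ifP => // _.
  by rewrite subrr normr0.
by rewrite lee_fin; apply: has_integral_le Hm H => y; exact: dom.
Qed.

End holder.
End partition.

(** * Variances of the two statistics *)

Section covariance_algebra.
Context {R : realType} (N : nat) (D m : 'I_N -> R) (Dmax K : R).
Hypothesis D0 : forall j, 0 <= D j <= Dmax.
Hypothesis mK : \sum_j `|m j| <= K.
Local Notation Gam j l := ((if j == l then D j else 0) - m j * m l).

(** Bounding each entry separately would cost a factor [N] more; the rank one part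
    is summable because the means are. *)
Lemma covariance_sqr_le :
  \sum_j \sum_l Gam j l ^+ 2 <= N%:R * Dmax ^+ 2 + K ^+ 4.
Proof.
have K0 : 0 <= K by apply: le_trans mK; apply: sumr_ge0 => j _.
have m2K : \sum_j m j ^+ 2 <= K ^+ 2.
  apply: (@le_trans _ _ (\sum_j K * `|m j|)); last first.
    by rewrite -mulr_sumr expr2 ler_wpM2l.
  apply: ler_sum => j _; rewrite -[leLHS]real_normK ?num_real// expr2 ler_wpM2r//.
  by apply: le_trans mK; rewrite (bigD1 j)//= lerDl sumr_ge0.
apply: (@le_trans _ _ (\sum_j \sum_l ((if j == l then D j ^+ 2 else 0) + m j ^+ 2 * m l ^+ 2))).
  apply: ler_sum => j _; apply: ler_sum => l _; case: eqVneq => [<-|_].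
    by have /andP[Dj _] := D0 j; have := mulr_ge0 Dj (sqr_ge0 (m j)); lra.
  by rewrite sub0r sqrrN exprMn add0r.
have -> : \sum_j \sum_l ((if j == l then D j ^+ 2 else 0) + m j ^+ 2 * m l ^+ 2) =
    \sum_j D j ^+ 2 + (\sum_j m j ^+ 2) * (\sum_l m l ^+ 2).
  rewrite big_distrlr -big_split; apply: eq_bigr => j _.
  by rewrite big_split -big_mkcond /= (big_pred1 j)// => l; exact: eq_sym.
apply: lerD.
  rewrite -[X in X%:R](card_ord N) mulr_natl -sumr_const; apply: ler_sum => j _.
  by have /andP[Dj DM] := D0 j; rewrite lerXn2r// nnegrE (le_trans Dj DM).
have s0 : 0 <= \sum_j m j ^+ 2 by apply: sumr_ge0 => j _; exact: sqr_ge0.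
by rewrite (_ : K ^+ 4 = K ^+ 2 * K ^+ 2) ?ler_pM//; ring.
Qed.

(** The rank one part only decreases the quadratic form. *)
Lemma covariance_quadratic_le (b : 'I_N -> R) :
  \sum_j \sum_l b j * b l * Gam j l <= Dmax * \sum_j b j ^+ 2.
Proof.
have -> : \sum_j \sum_l b j * b l * Gam j l =
    \sum_j D j * b j ^+ 2 - (\sum_j b j * m j) ^+ 2.
  rewrite expr2 big_distrlr /= -sumrB; apply: eq_bigr => j _.
  rewrite (bigD1 j)//= [in RHS](bigD1 j)//= eqxx opprD addrA; congr (_ + _); first by ring.
  rewrite -sumrN; apply: eq_bigr => l lj.
  by rewrite eq_sym (negbTE lj) sub0r; ring.
apply: (@le_trans _ _ (\sum_j D j * b j ^+ 2)).
  by rewrite gerBl sqr_ge0.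
rewrite mulr_sumr; apply: ler_sum => j _; rewrite ler_wpM2r ?sqr_ge0//.
by case/andP: (D0 j).
Qed.

End covariance_algebra.

Lemma sum_neq_shift {R : realType} (n : nat) (V : 'I_n -> R) (b : R) :
  \sum_i \sum_(k | k != i) (V i + b) * (V k + b) =
  \sum_i \sum_(k | k != i) V i * V k + 2 * (n%:R - 1) * b * \sum_i V i +
    n%:R * (n%:R - 1) * b ^+ 2.
Proof.
have E (F : 'I_n -> R) i : \sum_(k | k != i) F k = \sum_k F k - F i.
  by rewrite [in RHS](bigD1 i)//= addrAC subrr add0r.
have S1 (F : 'I_n -> R) : \sum_k (F k + b) = \sum_k F k + n%:R * b.
  by rewrite big_split sumr_const card_ord mulr_natl.
set T := \sum_i V i.
under eq_bigr do rewrite -mulr_sumr E S1 -/T.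
under [in RHS]eq_bigr do rewrite -mulr_sumr E -/T.
have -> : \sum_i (V i + b) * (T + n%:R * b - (V i + b)) =
    \sum_i (V i * (T - V i) + ((n%:R - 2) * b * V i + b * (T + (n%:R - 1) * b))).
  by apply: eq_bigr => i _; ring.
rewrite !big_split -mulr_sumr sumr_const card_ord -mulr_natl -/T /=; ring.
Qed.

Lemma sqrrD_le {R : realType} (x y : R) : (x + y) ^+ 2 <= 2 * x ^+ 2 + 2 * y ^+ 2.
Proof. by have := sqr_ge0 (x - y); rewrite sqrrB sqrrD; lra. Qed.

Section statistics.
Context {R : realType} (alpha : R) (psi : {mfun R >-> R}) (N : nat) (G : grid R N).
Context (n : nat) (X B : set R) (f : density X).
Hypothesis psi_bounded : exists M : R, forall u : R, `|psi u| <= M.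
Hypothesis alpha01 : 0 < alpha < 1.
Hypothesis n2 : (2 <= n)%N.
Hypothesis N1 : (1 <= N)%N.
Hypothesis GB : grid_partition G B.
Local Notation h := (hw G).
Local Notation M := (sup_norm psi).
Local Notation law := (private_law (@mechanism R alpha psi N G n)).
Local Notation sigma := (2 * M / (alpha * h)).
Local Notation v := ((M / (alpha * h)) ^+ 2).

Let h0 : 0 < h := hw_gt0 GB.
Let alpha0 : 0 < alpha. Proof. by case/andP: alpha01. Qed.
Let Mge0 : 0 <= M. Proof. exact: sup_norm_ge0. Qed.
Let n0 : 0 < n%:R :> R. Proof. by rewrite ltr0n; case: n n2. Qed.
Let n1 : 1 < n%:R :> R. Proof. by rewrite ltr1n. Qed.

Lemma half_kernel_mean (first : bool) j m : first ->
  has_integral (density_law f) (smooth psi G j) m ->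
  has_integral (marginal f (half_kernel alpha psi G first)) (fun z => out_vec z j - m) 0.
Proof. by case: first => // _; exact: marginal_coord_mean. Qed.

Lemma half_kernel_covariance (first : bool) (m : 'I_N -> R) j l k : first ->
  (forall j, has_integral (density_law f) (smooth psi G j) (m j)) ->
  has_integral (density_law f) (fun y => smooth psi G j y * smooth psi G l y) k ->
  has_integral (marginal f (half_kernel alpha psi G first))
    (fun z => (out_vec z j - m j) * (out_vec z l - m l))
    (k - m j * m l + sigma ^+ 2 * (if j == l then 2 else 0)).
Proof. by case: first => // _; exact: marginal_coord_covariance. Qed.

Lemma half_kernel_sign (first : bool) p (Y : R -> R) : ~~ first -> measurable_fun setT Y ->
  has_integral (density_law f) (out_prob alpha G) p ->
  has_integral (marginal f (half_kernel alpha psi G first)) (fun z => Y (out_real z))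
    (p * Y (c_alpha alpha) + (1 - p) * Y (- c_alpha alpha)).
Proof. by case: first => // _; exact: has_integral_marginal_sign. Qed.

(** The smoothed vector has at most one nonzero entry, so that its covariance
    matrix is a diagonal one minus a rank one matrix. *)
Lemma smooth_moments (m : 'I_N -> R) :
  (forall j, has_integral (density_law f) (smooth psi G j) (m j)) ->
  exists k : 'I_N -> R,
    [/\ forall j l, has_integral (density_law f)
          (fun y => smooth psi G j y * smooth psi G l y) (if j == l then k j else 0),
        forall j, 0 <= k j <= (M / h) ^+ 2 &
        \sum_j `|m j| <= M / h].
Proof.
move=> sm; have Mh : 0 <= M / h by rewrite divr_ge0// ltW.
have bnd j y : `|smooth psi G j y| <= M / h.
  apply: le_trans (norm_smooth_le psi_bounded h0 j y) _.
  by rewrite ler_piMr// indicE; case: (_ \in _).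
have sq j : {k | has_integral (density_law f) (fun y => smooth psi G j y ^+ 2) k}.
  apply: cid; apply: (@has_integral_bounded _ _ _ (density_law f) _ ((M / h) ^+ 2)) => [|y].
    by apply: measurable_funX; exact: measurable_smooth.
  by rewrite normrX lerXn2r ?nnegrE.
exists (fun j => sval (sq j)); split.
- move=> j l; case: eqVneq => [<-|jl].
    by apply: eq_has_integral (svalP (sq j)) => y; rewrite expr2.
  by apply: eq_has_integral (has_integral0 _) => y; rewrite (smoothM0 psi (trivIset_cell GB)).
- move=> j; apply/andP; split.
    by apply: has_integral_ge0 (svalP (sq j)) => y; exact: sqr_ge0.
  apply: has_integral_le (svalP (sq j)) (has_integral_cst _ ((M / h) ^+ 2)) => y.
  by rewrite -[leLHS]real_normK ?num_real// lerXn2r ?nnegrE.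
have nm j := has_integral_norm (sm j).
pose a j := sval (cid2 (nm j)).
have aH j : has_integral (density_law f) (fun y => `|smooth psi G j y|) (a j).
  by rewrite /a; case: cid2.
have am j : `|m j| <= a j by rewrite /a; case: cid2.
apply: (@le_trans _ _ (\sum_j a j)); first by apply: ler_sum => j _.
apply: has_integral_le (has_integral_sum _ (P := xpredT) (fun j _ => aH j))
  (has_integral_cst _ (M / h)) => y.
exact: sum_norm_smooth_le (trivIset_cell GB) y.
Qed.

(** The deviation from the squared bias splits into a degenerate U-statistic, of
    variance of order [N (v / n)^2], and a linear statistic, of variance of order
    [v / n] times the squared bias. *)
Lemma S_stat_second_moment (x0 : R -> R) (m : 'I_N -> R) :
  (forall j, has_integral (density_law f) (smooth psi G j) (m j)) ->
  let b j := m j - x0 (ctr G j) in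
  exists2 w, has_integral (law f) (fun z => (S_stat G x0 z - \sum_j b j ^+ 2) ^+ 2) w &
    w <= 656 * N%:R * (v / n%:R) ^+ 2 + 72 * (v / n%:R) * \sum_j b j ^+ 2.
Proof.
move=> sm b; have [k [kH k0 mK]] := smooth_moments sm.
pose D j := k j + 2 * sigma ^+ 2.
pose Gam j l := (if j == l then D j else 0) - m j * m l.
pose V j t (z : out R N (t < n)%N) := out_vec z j - m j.
pose A (t : 'I_(n + n)) := (t < n)%N.
pose P t := marginal f (@mechanism R alpha psi N G n t) : probability _ R.
have V0 j t : A t -> has_integral (P t) (@V j t) 0.
  by move=> At; exact: half_kernel_mean.
have VV j l t : A t -> has_integral (P t) (fun z => V j t z * V l t z) (Gam j l).
  move=> At; have := half_kernel_covariance At sm (kH j l).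
  rewrite (_ : _ - _ + _ = Gam j l)//.
  by rewrite /Gam /D; case: eqP => _; ring.
have M4 : (M / h) ^+ 2 <= v.
  rewrite lerXn2r ?nnegrE ?divr_ge0 ?mulr_ge0 ?(ltW h0) ?(ltW alpha0)//.
  rewrite ler_wpM2l// lef_pV2 ?posrE ?mulr_gt0// ler_piMl ?(ltW h0)//.
  by case/andP: alpha01 => _ /ltW.
have v0 : 0 <= v by exact: sqr_ge0.
have sv : sigma ^+ 2 = 4 * v by rewrite -mulrA exprMn; ring.
(* The smoothed value contributes [v] and the noise [8 v]. *)
have DD j : 0 <= D j <= 9 * v.
  by have /andP[k1 k2] := k0 j; rewrite /D sv; lra.
have GG : \sum_j \sum_l Gam j l ^+ 2 <= 82 * N%:R * v ^+ 2.
  apply: le_trans (covariance_sqr_le DD mK) _.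
  have N1' : 1 <= N%:R :> R by rewrite ler1n.
  have : (M / h) ^+ 4 <= v ^+ 2.
    rewrite (_ : (M / h) ^+ 4 = (M / h) ^+ 2 * (M / h) ^+ 2); last by ring.
    by rewrite [leRHS]expr2 ler_pM ?sqr_ge0.
  by have := sqr_ge0 v; nra.
have Gb : \sum_j \sum_l (b j * b l) * Gam j l <= 9 * v * \sum_j b j ^+ 2.
  exact: covariance_quadratic_le DD b.
have einj : injective (@lshift n n) by exact: lshift_inj.
have eA i : A (lshift n i) by exact: ltn_ord i.
have [u uH uG] := has_integral_ustat_sq V0 VV einj eA.
have bV0 j t : A t -> has_integral (P t) (fun z => b j * V j t z) 0.
  by move=> At; rewrite -(mulr0 (b j)); apply: has_integralZ; exact: V0.
have bVV j l t : A t ->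
    has_integral (P t) (fun z => (b j * V j t z) * (b l * V l t z)) (b j * b l * Gam j l).
  move=> At; apply: eq_has_integral (has_integralZ (b j * b l) (VV j l t At)) => z.
  by ring.
have lH := has_integral_linear_sq bV0 bVV einj eA.
pose C := (n%:R * (n%:R - 1))^-1 : R.
pose U (z : sample R N n) := \sum_i \sum_(k | k != i) \sum_j
  V j (lshift n i) (z (lshift n i)) * V j (lshift n k) (z (lshift n k)).
pose Lin (z : sample R N n) := \sum_i \sum_j b j * V j (lshift n i) (z (lshift n i)).
have E z : S_stat G x0 z - \sum_j b j ^+ 2 = C * U z + 2 / n%:R * Lin z.
  pose W (i : 'I_n) j := V j (lshift n i) (z (lshift n i)).
  have -> : U z = \sum_j \sum_i \sum_(k | k != i) W i j * W k j.
    rewrite [RHS]exchange_big; apply: eq_bigr => i _; exact: exchange_big.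
  have -> : Lin z = \sum_j b j * \sum_i W i j.
    by rewrite /Lin exchange_big; apply: eq_bigr => j _; rewrite mulr_sumr.
  rewrite /S_stat !mulr_sumr -sumrB -big_split; apply: eq_bigr => j _ /=.
  rewrite (_ : \sum_(i < n) _ = \sum_i \sum_(k | k != i) (W i j + b j) * (W k j + b j)).
    by rewrite sum_neq_shift /C; field; rewrite subr_eq0 !gt_eqF.
  apply: eq_bigr => i _; apply: eq_bigr => l _.
  by rewrite /W /V /b /Zvec; congr (_ * _); ring.
have U2 : has_integral (law f) (fun z => U z ^+ 2) u := uH.
have L2 : has_integral (law f) (fun z => Lin z ^+ 2) (n%:R * \sum_j \sum_l b j * b l * Gam j l) := lH.
have dH := has_integralD (has_integralZ (2 * C ^+ 2) U2)
  (has_integralZ (2 * (2 / n%:R) ^+ 2) L2).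
have le_d z : `|(S_stat G x0 z - \sum_j b j ^+ 2) ^+ 2| <=
    2 * C ^+ 2 * U z ^+ 2 + 2 * (2 / n%:R) ^+ 2 * Lin z ^+ 2.
  rewrite ger0_norm ?sqr_ge0// E; apply: le_trans (sqrrD_le _ _) _.
  by rewrite (exprMn 2 C) (exprMn 2 (2 / n%:R)) !mulrA.
have mS : measurable_fun setT (fun z : sample R N n => (S_stat G x0 z - \sum_j b j ^+ 2) ^+ 2).
  by apply: measurable_funX; apply: measurable_funB => //; exact: measurable_S_stat.
have [w wH] := has_integral_dom mS le_d dH; exists w => //.
apply: (@le_trans _ _ (2 * C ^+ 2 * u +
    2 * (2 / n%:R) ^+ 2 * (n%:R * \sum_j \sum_l b j * b l * Gam j l))).
  apply: has_integral_le wH dH => z; exact: le_trans (ler_norm _) (le_d z).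
have np : 0 < n%:R * (n%:R - 1) :> R by rewrite mulr_gt0 ?subr_gt0.
(* 656 = 2 * 2 * 2 * 82: from the square of a sum, from the variance of the
   U-statistic, and from [n (n - 1) >= n^2 / 2]. *)
apply: lerD.
  have C2 : C <= 2 / n%:R ^+ 2.
    rewrite /C ler_pdivlMr ?exprn_gt0// mulrC ler_pdivrMr//.
    have n2' : 2 <= n%:R :> R by rewrite ler_nat.
    by have := ler_wpM2l (ltW n0) n2'; lra.
  have C0 : 0 < C by rewrite invr_gt0.
  apply: (@le_trans _ _ (2 * C ^+ 2 * (n%:R * (n%:R - 1) * 2 * (82 * N%:R * v ^+ 2)))).
    apply: ler_wpM2l; first by rewrite mulr_ge0 ?sqr_ge0.
    apply: le_trans uG _; apply: ler_wpM2l => //.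
    by rewrite mulr_ge0 ?(ltW np).
  rewrite (_ : 2 * C ^+ 2 * _ = C * (328 * N%:R * v ^+ 2)); last first.
    by rewrite /C; field; rewrite subr_eq0 !gt_eqF.
  rewrite (_ : 656 * N%:R * _ = 2 / n%:R ^+ 2 * (328 * N%:R * v ^+ 2)); last first.
    by field; rewrite !gt_eqF// mulr_gt0.
  by rewrite ler_wpM2r// mulr_ge0 ?sqr_ge0// mulr_ge0.
(* 72 = 2 * 2^2 * 9. *)
rewrite (_ : 2 * _ * _ = 8 / n%:R * \sum_j \sum_l b j * b l * Gam j l); last first.
  by field; rewrite gt_eqF.
rewrite (_ : 72 * _ * _ = 8 / n%:R * (9 * v * \sum_j b j ^+ 2)); last first.
  by field; rewrite !gt_eqF// mulr_gt0.
by rewrite ler_wpM2l// divr_ge0// ltW.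
Qed.

(** The privatised indicators have mean [P_f (~` B)] and are bounded by
    [c_alpha], which is of order [1 / alpha]. *)
Lemma T_stat_second_moment (f0 : R -> R) :
  let tau := (\int[lebesgue_measure]_(x in X `\` B) f x)%R -
             (\int[lebesgue_measure]_(x in X `\` B) f0 x)%R in
  exists2 w, has_integral (law f) (fun z => (T_stat X B f0 z - tau) ^+ 2) w &
    w <= 9 / (n%:R * alpha ^+ 2).
Proof.
move=> tau; set q0 := (\int[lebesgue_measure]_(x in X `\` B) f0 x)%R in tau *.
set q := (\int[lebesgue_measure]_(x in X `\` B) f x)%R in tau *.
set c := c_alpha alpha; have c1 : 1 < c := c_alpha_gt1 alpha01.
have qH : has_integral (density_law f) (\1_(~` B)) q by exact: (has_integral_outside GB).
have BE : \bigcup_j closed_cell G j = B by case: GB.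
pose p := 2^-1 * (1 + q / c).
have pH : has_integral (density_law f) (out_prob alpha G) p.
  have := has_integralZ 2^-1 (has_integralD (has_integral_cst _ 1) (has_integralZ c^-1 qH)).
  rewrite [X in has_integral _ _ X -> _](_ : _ = p); last by rewrite /p; ring.
  by apply: eq_has_integral => x; rewrite /out_prob BE /c; ring.
pose V (_ : unit) t (z : out R N (t < n)%N) := out_real z - q.
pose A (t : 'I_(n + n)) := ~~ (t < n)%N.
pose P t := marginal f (@mechanism R alpha psi N G n t) : probability _ R.
have V0 j t : A t -> has_integral (P t) (@V j t) 0.
  move=> At; have mY : measurable_fun setT (fun y : R => y - q) by exact: measurable_funB.
  have := half_kernel_sign At mY pH; rewrite (_ : _ + _ = 0)//.
  by rewrite /p -/c; field; rewrite gt_eqF// (lt_trans ltr01).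
have VV j l t : A t -> has_integral (P t) (fun z => V j t z * V l t z) (c ^+ 2 - q ^+ 2).
  move=> At; have mY : measurable_fun setT (fun y : R => (y - q) * (y - q)).
    by apply: measurable_funM; exact: measurable_funB.
  have := half_kernel_sign At mY pH; rewrite (_ : _ + _ = c ^+ 2 - q ^+ 2)//.
  by rewrite /p -/c; field; rewrite gt_eqF// (lt_trans ltr01).
have einj : injective (@rshift n n) by exact: rshift_inj.
have eA i : A (rshift n i) by rewrite /A /= -leqNgt leq_addr.
have := has_integralZ (n%:R^-1 ^+ 2) (has_integral_linear_sq V0 VV einj eA).
move=> H; exists (n%:R^-1 ^+ 2 * (n%:R * \sum_(j : unit) \sum_(l : unit) (c ^+ 2 - q ^+ 2))).
  apply: eq_has_integral H => z; rewrite -exprMn; congr (_ ^+ 2).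
  rewrite /T_stat /tau -/q0 opprB addrA subrK.
  under eq_bigr do rewrite big_const card_unit /= addr0.
  by rewrite sumrB sumr_const card_ord -[q *+ n]mulr_natl mulrBr mulKf ?gt_eqF.
rewrite !big_const !card_unit /= !addr0.
have c0 : 0 < c := lt_trans ltr01 c1.
(* From [expR alpha >= 1 + alpha] follows [alpha * c <= alpha + 2]. *)
have ca : alpha * c <= 3.
  have e1 := expR_ge1Dx alpha; have /andP[_ a1] := alpha01.
  rewrite /c /c_alpha mulrA ler_pdivrMr; last by have := alpha0; lra.
  by have := alpha0; nra.
rewrite ler_pdivlMr ?mulr_gt0 ?exprn_gt0//.
rewrite (_ : _ * (n%:R * alpha ^+ 2) = (alpha * c) ^+ 2 - (alpha * q) ^+ 2); last first.
  by field; rewrite gt_eqF.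
have := sqr_ge0 (alpha * q); have : 0 <= alpha * c by rewrite mulr_ge0 ?ltW.
by nra.
Qed.

End statistics.

(** * Exponents of the rate *)

Section powers.
Context {R : realType} (V a beta h c1 c2 : R).
Hypotheses (V0 : 0 < V) (a0 : 0 < a) (beta01 : 0 < beta <= 1) (h0 : 0 < h).
Local Notation k := (4 * beta + 3).
Local Notation bw := (V `^ (- (1 / k)) * a `^ (- (2 / k))).
Local Notation R1 := (V `^ ((3 * beta + 3) / k) * a `^ (- (2 * beta / k))).

(** The two equations that determine the bandwidth: with it, the bias and the noise
    below are both of the order of [R1]. *)
Lemma bandwidth_balance : V * bw `^ beta = R1 /\ (V / bw) `^ (3 / 2) / a = R1 ^+ 2.
Proof.
have k0 : k != 0 by case/andP: beta01 => b0 _; rewrite gt_eqF//; lra.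
have [lv lvE] := expR_total V0; have [la laE] := expR_total a0.
have pE l e : (expR l) `^ e = expR (e * l) :> R by rewrite mulrC expRM.
rewrite -!lvE -!laE !pE; split.
  by rewrite -!expRD !pE -!expRD; congr expR; field.
by rewrite expr2 -!expRD -!expRN -!expRD !pE -!expRD; congr expR; field.
Qed.

Lemma bw_gt0 : 0 < bw.
Proof. by rewrite mulr_gt0 ?powR_gt0. Qed.

Lemma R1_ge0 : 0 <= R1.
Proof. by rewrite mulr_ge0 ?powR_ge0. Qed.

Lemma bias_rate : 0 < c2 -> h <= c2 * bw -> V * h `^ beta <= Num.max 1 c2 * R1.
Proof.
move=> c20 hc; have [<- _] := bandwidth_balance; have /andP[b0 b1] := beta01.
rewrite mulrCA ler_wpM2l ?(ltW V0)//.
have m1 : 1 <= Num.max 1 c2 by rewrite le_max lexx.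
have mc : c2 <= Num.max 1 c2 by rewrite le_max lexx orbT.
have := bw_gt0; move: hc; set w := bw => hc w0.
apply: (@le_trans _ _ ((Num.max 1 c2 * w) `^ beta)).
  apply: ge0_ler_powR; rewrite ?nnegrE ?(ltW h0) ?(ltW b0)//.
    by rewrite mulr_ge0 ?(ltW w0)// (le_trans _ m1).
  by apply: le_trans hc _; rewrite ler_wpM2r ?(ltW w0).
rewrite powRM ?(ltW w0) ?(le_trans _ m1)// ler_wpM2r ?powR_ge0//.
exact: ler1_powR.
Qed.

Lemma noise_rate (N : R) : 0 < c1 -> c1 * bw <= h -> 0 <= N -> N <= V / h ->
  Num.sqrt (N * Num.sqrt N / a) <= c1 `^ (- (3 / 4)) * R1.
Proof.
move=> c10 ch N0 NV.
have w0 := bw_gt0; have [_ E] := bandwidth_balance.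
have R10 : 0 <= c1 `^ (- (3 / 4)) * R1 by rewrite mulr_ge0 ?powR_ge0 ?R1_ge0.
rewrite -[leRHS]ger0_norm// -sqrtr_sqr ler_wsqrtr// exprMn -E mulrA ler_wpM2r ?invr_ge0 ?(ltW a0)//.
have -> : N * Num.sqrt N = N `^ (3 / 2).
  rewrite (_ : 3 / 2 = 1 + 2^-1); last by lra.
  rewrite powRD ?powRr1 ?powR12_sqrt//.
  by apply/implyP => /eqP; lra.
have -> : (c1 `^ (- (3 / 4))) ^+ 2 = c1^-1 `^ (3 / 2).
  rewrite -powR_mulrn ?powR_ge0// -powRrM -(powR_inv1 (ltW c10)) -powRrM.
  by congr powR; lra.
rewrite -powRM ?invr_ge0 ?divr_ge0 ?(ltW c10) ?(ltW V0) ?(ltW w0)//.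
apply: ge0_ler_powR; rewrite ?nnegrE//.
  by rewrite mulr_ge0 ?invr_ge0 ?divr_ge0 ?(ltW c10) ?(ltW V0) ?(ltW w0).
apply: le_trans NV _; rewrite mulrCA ler_wpM2l ?(ltW V0)// -invfM.
by rewrite lef_pV2 ?posrE// mulr_gt0.
Qed.

End powers.

(** * Type I error *)

Lemma measurable_bool_set {R : realType} {d} {T : measurableType d} (p : T -> bool) :
  measurable_fun setT p -> measurable [set z | p z].
Proof.
move=> mp; rewrite (_ : mkset _ = setT `&` p @^-1` [set true]); first exact: mp.
by rewrite setTI.
Qed.

Section arithmetic.
Context {R : realType}.

Lemma type1_gap (y y0 g S : R) : y <= y0 -> 3 / 2 * y0 + g <= S -> y0 / 2 + g <= S - y.
Proof. lra. Qed.

Lemma type1_gap_gt0 (s y0 gamma : R) : 0 < s -> 0 <= y0 -> 0 < gamma ->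
  0 < y0 / 2 + 196 * s / gamma.
Proof.
move=> s0 y00 g0; have : 0 < 196 * s / gamma by rewrite divr_gt0// mulr_gt0.
lra.
Qed.

(** The term linear in [s] is absorbed by the cross product of the square, thanks to
    the part [y0 / 2] of the gap; with [196 >= 180 = 72 * 5 / 2] the share
    [2 / 5] of [gamma] suffices. *)
Lemma type1_arith (s y y0 gamma : R) : 0 < s -> 0 <= y -> y <= y0 -> 0 < gamma < 1 ->
  (656 * s ^+ 2 + 72 * s * y) / (y0 / 2 + 196 * s / gamma) ^+ 2 <= 2 / 5 * gamma.
Proof.
move=> s0 yge0 yy0 /andP[g0 g1]; have y00 := le_trans yge0 yy0.
rewrite ler_pdivrMr ?exprn_gt0 ?type1_gap_gt0//.
pose u := s / gamma; have u0 : 0 < u by rewrite divr_gt0.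
have su : s = gamma * u by rewrite /u; field; rewrite gt_eqF.
rewrite (_ : 196 * s / gamma = 196 * u); last by rewrite /u; ring.
rewrite su; clearbody u.
have uy : u * y <= u * y0 by rewrite ler_wpM2l// ltW.
have uy0 : 0 <= u * y0 by rewrite mulr_ge0// ltW.
(* The small constant 42 is enough, as [42^2 * 2 / 5] exceeds 656. *)
have e2 : 196 * (u * y0) + 42 * 42 * u ^+ 2 <= (y0 / 2 + 196 * u) ^+ 2.
  have : (42 * u) ^+ 2 <= (196 * u) ^+ 2.
    by rewrite lerXn2r ?nnegrE ?ler_wpM2r ?mulr_ge0 ?(ltW u0)// ler_nat.
  have := sqr_ge0 (y0 / 2); rewrite sqrrD !exprMn.
  rewrite (_ : y0 / 2 * (196 * u) *+ 2 = 196 * (u * y0)); last by field.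
  lra.
apply: (@le_trans _ _ (gamma * (656 * u ^+ 2 + 72 * (u * y0)))).
  have ug : gamma * u ^+ 2 <= u ^+ 2 by rewrite ler_piMl ?sqr_ge0// ltW.
  have := ler_wpM2l (ltW g0) ug; have := ler_wpM2l (ltW g0) uy.
  by rewrite exprMn; lra.
move: e2; set E := (y0 / 2 + 196 * u) ^+ 2; clearbody E => e2.
have := mulr_ge0 (ltW g0) (sqr_ge0 u); have := mulr_ge0 (ltW g0) uy0.
have := ler_wpM2l (ltW g0) e2; lra.
Qed.

End arithmetic.

Section errors.
Context {R : realType} (alpha beta gamma L L0 : R) (psi : {mfun R >-> R}) (N : nat).
Context (G : grid R N) (n : nat) (X B : set R) (f0 : density X).
Hypothesis psi_bounded : exists M : R, forall u : R, `|psi u| <= M.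
Hypothesis psi_support : forall u : R, ~ (-1 <= u <= 1) -> psi u = 0.
Hypothesis psi_int : (\int[lebesgue_measure]_(u in `[(-1)%R, 1%R]) psi u)%R = 1.
Hypothesis gamma01 : 0 < gamma < 1.
Hypothesis alpha01 : 0 < alpha < 1.
Hypothesis beta01 : 0 < beta <= 1.
Hypothesis L0L : 0 < L0 < L.
Hypothesis n2 : (2 <= n)%N.
Hypothesis N1 : (1 <= N)%N.
Hypothesis f0H : holder X beta L0 f0.
Hypothesis BX : B `<=` X.
Hypothesis GB : grid_partition G B.
Local Notation h := (hw G).
Local Notation M := (sup_norm psi).
Local Notation C := (C_beta beta psi).
Local Notation Q := (@mechanism R alpha psi N G n).
Local Notation t1 := (thr1 alpha beta gamma L0 psi N n h).
Local Notation t2 := (thr2 alpha gamma n).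
Local Notation phi := (Phi X G B f0 t1 t2).
Local Notation outside f := (\int[lebesgue_measure]_(x in X `\` B) f x)%R.
Local Notation a := (n%:R * alpha ^+ 2).
Local Notation s := (Num.sqrt N%:R * ((M / (alpha * h)) ^+ 2 / n%:R)).

Let h0 : 0 < h := hw_gt0 GB.
Let alpha0 : 0 < alpha. Proof. by case/andP: alpha01. Qed.
Let gamma0 : 0 < gamma. Proof. by case/andP: gamma01. Qed.
Let M0 : 0 < M. Proof. exact: sup_norm_gt0. Qed.
Let n0 : 0 < n%:R :> R. Proof. by rewrite ltr0n; case: n n2. Qed.
Let a0 : 0 < a. Proof. by rewrite mulr_gt0 ?exprn_gt0. Qed.
Let sN1 : 1 <= Num.sqrt N%:R :> R.
Proof. by rewrite -[leLHS]sqrtr1 ler_wsqrtr// ler1n. Qed.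

Lemma noise_level_gt0 : 0 < s.
Proof. by rewrite mulr_gt0 ?(lt_le_trans ltr01 sN1)// divr_gt0 ?exprn_gt0 ?divr_gt0 ?mulr_gt0. Qed.

Lemma thr1E : t1 = 3 / 2 * (N%:R * (L0 * h `^ beta * C) ^+ 2) + 196 * s / gamma.
Proof.
rewrite /thr1 (_ : h `^ (2 * beta) = (h `^ beta) ^+ 2); last first.
  by rewrite -powR_mulrn ?powR_ge0// -powRrM mulrC.
by field; rewrite !gt_eqF.
Qed.

Lemma thr2_sqr : t2 ^+ 2 = 20 / (a * gamma) /\ 0 < t2.
Proof.
have x0 : 0 < 20 / (a * gamma) by rewrite divr_gt0 ?mulr_gt0.
by rewrite /thr2 sqr_sqrtr ?(ltW x0)// sqrtr_gt0.
Qed.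

(** Both variances are expressed with the noise level [s] that occurs in the
    threshold, at the cost of a factor [sqrt N] in the second. *)
Lemma S_stat_chebyshev (f : density X) (m : 'I_N -> R) e (A : set (sample R N n)) :
  (forall j, has_integral (density_law f) (smooth psi G j) (m j)) ->
  measurable A -> 0 < e ->
  let y := \sum_j (m j - f0 (ctr G j)) ^+ 2 in
  (forall z, A z -> e <= `|S_stat G f0 z - y|) ->
  (private_law Q f A <= ((656 * s ^+ 2 + 72 * s * y) / e ^+ 2)%:E)%E.
Proof.
move=> sm mA e0 y Ae.
have [w wH wle] := S_stat_second_moment psi_bounded alpha01 n2 N1 GB f0 sm.
apply: le_trans (chebyshev_second_moment mA e0 Ae wH) _.
rewrite lee_fin ler_wpM2r ?invr_ge0 ?sqr_ge0//; apply: le_trans wle _.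
set u := (M / (alpha * h)) ^+ 2 / n%:R; have u0 : 0 <= u by rewrite divr_ge0 ?sqr_ge0 ?ltW.
clearbody u; apply: lerD.
  by rewrite exprMn sqr_sqrtr ?ler0n//; lra.
rewrite ler_wpM2r//; first by apply: sumr_ge0 => j _; exact: sqr_ge0.
by rewrite ler_wpM2l// ler_peMl.
Qed.

Lemma T_stat_chebyshev (f : density X) e (A : set (sample R N n)) :
  measurable A -> 0 < e ->
  (forall z, A z -> e <= `|T_stat X B f0 z - (outside f - outside f0)|) ->
  (private_law Q f A <= (9 / a / e ^+ 2)%:E)%E.
Proof.
move=> mA e0 Ae; have [w wH wle] := T_stat_second_moment psi f alpha01 n2 GB f0.
apply: le_trans (chebyshev_second_moment mA e0 Ae wH) _.
by rewrite lee_fin ler_wpM2r ?invr_ge0 ?sqr_ge0.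
Qed.

Lemma measurable_S_event c : measurable [set z : sample R N n | c <= S_stat G f0 z].
Proof.
apply: (@measurable_bool_set R); apply: measurable_fun_ler => //.
exact: measurable_S_stat.
Qed.

Lemma measurable_T_event c : measurable [set z : sample R N n | c <= T_stat X B f0 z].
Proof.
apply: (@measurable_bool_set R); apply: measurable_fun_ler => //.
exact: measurable_T_stat.
Qed.

Lemma smooth_means (f : density X) : exists m : 'I_N -> R,
  forall j, has_integral (density_law f) (smooth psi G j) (m j).
Proof.
have H j : {k | has_integral (density_law f) (smooth psi G j) k}.
  apply: cid; apply: (@has_integral_bounded _ _ _ _ _ (M / h)) => [|y].
    exact: measurable_smooth.
  apply: le_trans (norm_smooth_le psi_bounded h0 j y) _.
  by rewrite ler_piMr ?divr_ge0 ?(ltW M0) ?(ltW h0)// indicE; case: (_ \in _).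
by exists (fun j => sval (H j)) => j; exact: svalP (H j).
Qed.

(** [S_B] has the share [2 / 5] of [gamma] and [T_B] the share
    [9 / 20]: its variance is at most [9 / (n alpha^2)] whereas
    [t2^2 = 20 / (n alpha^2 gamma)]. *)
Lemma type1_error_le : (type1_error Q phi f0 <= (9 / 10 * gamma)%:E)%E.
Proof.
have [m sm] := smooth_means f0; pose y := \sum_j (m j - f0 (ctr G j)) ^+ 2.
have s0 := noise_level_gt0.
pose y0 := N%:R * (L0 * h `^ beta * C) ^+ 2.
have yy0 : y <= y0.
  rewrite /y0 -[X in X%:R](card_ord N) mulr_natl -sumr_const; apply: ler_sum => j _.
  have mj := smooth_bias psi_bounded psi_support psi_int BX GB beta01 f0H (sm j).
  rewrite -[leLHS]real_normK ?num_real// lerXn2r// nnegrE//.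
  exact: le_trans mj.
have y00 : 0 <= y by apply: sumr_ge0 => j _; exact: sqr_ge0.
pose e := y0 / 2 + 196 * s / gamma.
have y0p : 0 <= y0 := le_trans y00 yy0.
have e0 : 0 < e := type1_gap_gt0 s0 y0p gamma0.
have [t2E t20] := thr2_sqr.
pose AS := [set z : sample R N n | t1 <= S_stat G f0 z].
pose AT := [set z : sample R N n | t2 <= T_stat X B f0 z].
have PS : (private_law Q f0 AS <= ((656 * s ^+ 2 + 72 * s * y) / e ^+ 2)%:E)%E.
  apply: S_stat_chebyshev => //; first exact: measurable_S_event.
  move=> z; rewrite /AS /= thr1E -/y0 -/y => zt; apply: le_trans (ler_norm _).
  exact: type1_gap yy0 zt.
have PT : (private_law Q f0 AT <= (9 / a / t2 ^+ 2)%:E)%E.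
  apply: T_stat_chebyshev => //; first exact: measurable_T_event.
  by move=> z zt; rewrite subrr subr0; apply: le_trans (ler_norm _).
rewrite /type1_error (_ : mkset _ = AS `|` AT); last first.
  by apply/seteqP; split => z /=; [move/orP|move=> H; apply/orP].
apply: le_trans (measureU2 _ _ _) _; [exact: measurable_S_event|exact: measurable_T_event|].
apply: le_trans (leeD PS PT) _; rewrite -EFinD lee_fin.
have HS := type1_arith s0 y00 yy0 gamma01.
have HT : 9 / a / t2 ^+ 2 <= 9 / 20 * gamma.
  by rewrite t2E le_eqVlt; apply/orP; left; apply/eqP; field; rewrite !gt_eqF.
rewrite (_ : 9 / 10 * gamma = 2 / 5 * gamma + (9 / 20 * gamma + gamma / 20)); last by field.
by rewrite lerD// (le_trans HT)// lerDl divr_ge0 ?(ltW gamma0).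
Qed.

End errors.

(** * Type II error *)

Section arithmetic.
Context {R : realType}.

(** When [y] dominates [s / gamma], half of [y] is many standard deviations:
    [4 * 72 / 60^2 = 2 / 25] leaves room for the quadratic term. *)
Lemma type2_arith (s y gamma : R) : 0 < s -> 0 < gamma < 1 -> 60 ^+ 2 * (s / gamma) <= y ->
  (656 * s ^+ 2 + 72 * s * y) / (y / 2) ^+ 2 <= gamma / 10.
Proof.
move=> s0 /andP[g0 g1]; set u := s / gamma => uy.
have u0 : 0 < u by rewrite divr_gt0.
have su : s = gamma * u by rewrite /u; field; rewrite gt_eqF.
rewrite su; clearbody u.
have y0 : 0 < y by rewrite (lt_le_trans _ uy)// mulr_gt0 ?exprn_gt0.
rewrite ler_pdivrMr ?exprn_gt0 ?divr_gt0//.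
have uu : u * (60 ^+ 2 * u) <= u * y by rewrite ler_wpM2l// ltW.
have uyy : (60 ^+ 2 * u) * y <= y * y by rewrite ler_wpM2r// ltW.
have ug : gamma * u ^+ 2 <= u ^+ 2 by rewrite ler_piMl ?sqr_ge0// ltW.
have yy : 656 * (gamma * u ^+ 2) + 72 * (u * y) <= y ^+ 2 / 40.
  have := sqr_ge0 u; have := mulr_ge0 (ltW u0) (ltW y0); lra.
have := ler_wpM2l (ltW g0) yy; rewrite exprMn; lra.
Qed.

Lemma type2_threshold (A w N s gamma : R) : A <= (2 * w) ^+ 2 -> 0 <= N -> 0 <= s / gamma ->
  2 * (3 / 2 * (N * A) + 196 * s / gamma) <= 12 * w ^+ 2 * N + 60 ^+ 2 * (s / gamma).
Proof.
move=> Aw N0 u0; have := ler_wpM2l N0 Aw; rewrite exprMn.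
rewrite -(mulrA 196); lra.
Qed.

(** By the Cauchy-Schwarz inequality: it links the l1 norm of the bias, which the L1
    distance between densities controls, to its square, which [S_B] estimates. *)
Lemma sum_norm_le_sqrt (N : nat) (b : 'I_N -> R) :
  \sum_j `|b j| <= Num.sqrt N%:R * Num.sqrt (\sum_j b j ^+ 2).
Proof.
have S0 : 0 <= \sum_j `|b j| by apply: sumr_ge0.
rewrite -sqrtrM ?ler0n// -[leLHS]ger0_norm// -sqrtr_sqr ler_wsqrtr//.
rewrite expr2 big_distrlr /=.
have -> : N%:R * \sum_j b j ^+ 2 = \sum_j \sum_l (b j ^+ 2 + b l ^+ 2) / 2.
  have E1 : \sum_(j < N) \sum_(l < N) b l ^+ 2 = N%:R * \sum_j b j ^+ 2.
    by rewrite sumr_const card_ord mulr_natl.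
  have E2 : \sum_(j < N) \sum_(l < N) b j ^+ 2 = N%:R * \sum_j b j ^+ 2.
    by rewrite exchange_big E1.
  transitivity ((\sum_(j < N) \sum_(l < N) b j ^+ 2 + \sum_(j < N) \sum_(l < N) b l ^+ 2) / 2).
    by rewrite E1 E2; field.
  rewrite -big_split mulr_suml; apply: eq_bigr => j _.
  by rewrite -big_split mulr_suml.
apply: ler_sum => j _; apply: ler_sum => l _.
have := sqr_ge0 (`|b j| - `|b l|).
rewrite -(real_normK (num_real (b j))) -(real_normK (num_real (b l))); lra.
Qed.

End arithmetic.

Section type2.
Context {R : realType} (alpha beta gamma L L0 : R) (psi : {mfun R >-> R}) (N : nat).
Context (G : grid R N) (n : nat) (X B : set R) (f0 f : density X).
Hypothesis psi_bounded : exists M : R, forall u : R, `|psi u| <= M.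
Hypothesis psi_support : forall u : R, ~ (-1 <= u <= 1) -> psi u = 0.
Hypothesis psi_int : (\int[lebesgue_measure]_(u in `[(-1)%R, 1%R]) psi u)%R = 1.
Hypothesis gamma01 : 0 < gamma < 1.
Hypothesis alpha01 : 0 < alpha < 1.
Hypothesis beta01 : 0 < beta <= 1.
Hypothesis L0L : 0 < L0 < L.
Hypothesis n2 : (2 <= n)%N.
Hypothesis N1 : (1 <= N)%N.
Hypothesis f0H : holder X beta L0 f0.
Hypothesis fH : holder X beta L f.
Hypothesis BX : B `<=` X.
Hypothesis GB : grid_partition G B.
Local Notation h := (hw G).
Local Notation M := (sup_norm psi).
Local Notation C := (C_beta beta psi).
Local Notation Q := (@mechanism R alpha psi N G n).
Local Notation t1 := (thr1 alpha beta gamma L0 psi N n h).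
Local Notation t2 := (thr2 alpha gamma n).
Local Notation phi := (Phi X G B f0 t1 t2).
Local Notation outside f := (\int[lebesgue_measure]_(x in X `\` B) f x)%R.
Local Notation a := (n%:R * alpha ^+ 2).
Local Notation s := (Num.sqrt N%:R * ((M / (alpha * h)) ^+ 2 / n%:R)).
Local Notation g := (Num.sqrt (a * gamma)).

Let h0 : 0 < h := hw_gt0 GB.
Let alpha0 : 0 < alpha. Proof. by case/andP: alpha01. Qed.
Let gamma0 : 0 < gamma. Proof. by case/andP: gamma01. Qed.
Let M0 : 0 < M. Proof. exact: sup_norm_gt0. Qed.
Let n0 : 0 < n%:R :> R. Proof. by rewrite ltr0n; case: n n2. Qed.
Let a0 : 0 < a. Proof. by rewrite mulr_gt0 ?exprn_gt0. Qed.
Let L_ge0 : 0 < L. Proof. by case/andP: L0L; exact: lt_trans. Qed.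
Let s0 : 0 < s. Proof. exact: (noise_level_gt0 psi_bounded psi_int alpha01 n2 N1 GB). Qed.
Let g0 : 0 < g. Proof. by rewrite sqrtr_gt0 mulr_gt0. Qed.
Let g2 : g ^+ 2 = a * gamma. Proof. by rewrite sqr_sqrtr// mulr_ge0 ?ltW. Qed.

Let measurable_accept : measurable [set z : sample R N n | ~~ phi z].
Proof.
rewrite (_ : mkset _ = ~` [set z | phi z]); last by apply/seteqP; split => z /negP.
by apply: measurableC; apply: (@measurable_bool_set R); exact: measurable_Phi.
Qed.

Lemma thr2_le : t2 <= 5 / g.
Proof.
have [t2E t20] := thr2_sqr gamma01 alpha01 n2.
rewrite -[leLHS]ger0_norm ?(ltW t20)// -[leRHS]ger0_norm ?divr_ge0 ?(ltW g0)//.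
rewrite -!sqrtr_sqr ler_wsqrtr// t2E exprMn exprVn g2.
apply: ler_wpM2r; last by lra.
by rewrite invr_ge0 mulr_ge0 ?(ltW a0) ?(ltW gamma0).
Qed.

(** As [t2 <= 5 / g], the mean of [T_B] exceeds its threshold by [10 / g], which is
    at least [3 / sqrt gamma] times its standard deviation. *)
Lemma type2_error_outside : 15 / g <= outside f - outside f0 ->
  (type2_error Q phi f <= (gamma / 10)%:E)%E.
Proof.
move=> tau15; apply: (@le_trans _ _ (9 / a / (10 / g) ^+ 2)%:E).
  apply: (T_stat_chebyshev (f0 := f0) psi alpha01 n2 GB) => //; first by rewrite divr_gt0.
  move=> z /=; rewrite negb_or -!ltNge => /andP[_ Tz].
  rewrite distrC; apply: le_trans (ler_norm _); have := thr2_le.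
  by move: tau15 Tz; lra.
rewrite lee_fin exprMn exprVn g2.
rewrite (_ : 9 / a / _ = 9 / 100 * gamma); last by field; rewrite !gt_eqF.
by have := gamma0; lra.
Qed.

Section inside.
Variable m : 'I_N -> R.
Hypothesis sm : forall j, has_integral (density_law f) (smooth psi G j) (m j).
Local Notation y := (\sum_j (m j - f0 (ctr G j)) ^+ 2).
Local Notation Y := (12 * (L * M * h `^ beta) ^+ 2 * N%:R + 60 ^+ 2 * (s / gamma)).

(** Once [y] is at least twice the threshold, accepting requires [S_B] to fall below
    half of its mean. *)
Lemma type2_error_inside : Y <= y -> (type2_error Q phi f <= (gamma / 10)%:E)%E.
Proof.
move=> Yy.
have sg0 : 0 <= s / gamma by rewrite divr_ge0 ?ltW.
have B0 : 0 <= (L * M * h `^ beta) ^+ 2 * N%:R by rewrite mulr_ge0 ?sqr_ge0 ?ler0n.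
have t1y : 2 * t1 <= y.
  apply: le_trans Yy; rewrite (thr1E beta L0 psi gamma01 alpha01 n2 GB).
  have LC : (L0 * h `^ beta * C) ^+ 2 <= (2 * (L * M * h `^ beta)) ^+ 2.
    have C0 := C_beta_ge0 psi_bounded psi_support beta01.
    have C2 := C_beta_le psi_bounded psi_support beta01.
    have /andP[L00 LL] := L0L; have x0 := powR_ge0 h beta.
    rewrite lerXn2r ?nnegrE ?mulr_ge0 ?(ltW L00) ?(ltW M0) ?(ltW L_ge0)//.
    rewrite (_ : 2 * _ = L * h `^ beta * (2 * M)); last by ring.
    by rewrite ler_pM ?mulr_ge0 ?(ltW L00)// ler_wpM2r// ltW.
  exact: type2_threshold.
have y0 : 0 < y.
  apply: lt_le_trans Yy; rewrite ltr_wpDl//; first by rewrite -mulrA mulr_ge0.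
  by rewrite mulr_gt0 ?exprn_gt0 ?divr_gt0.
apply: (@le_trans _ _ ((656 * s ^+ 2 + 72 * s * y) / (y / 2) ^+ 2)%:E).
  apply: (S_stat_chebyshev (f0 := f0) psi_bounded alpha01 n2 N1 GB sm) => //; first by rewrite divr_gt0.
  move=> z /=; rewrite negb_or -!ltNge => /andP[Sz _].
  rewrite distrC; apply: le_trans (ler_norm _).
  by move: t1y Sz; lra.
rewrite lee_fin; apply: type2_arith => //; apply: le_trans Yy.
by rewrite lerDr -mulrA mulr_ge0.
Qed.

Local Notation x := (h `^ beta).
Local Notation u := (s / gamma).

(* The noise term [sqrt (N s / gamma)], in the form which the choice of the
   bandwidth controls. *)
Let noise_sqrt : h * (Num.sqrt N%:R * Num.sqrt u) =
  M * Num.sqrt (N%:R * Num.sqrt N%:R / a) / Num.sqrt gamma.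
Proof.
have u0 : 0 <= u by rewrite divr_ge0 ?ltW.
have w0 : 0 <= N%:R * Num.sqrt N%:R / a.
  by apply: divr_ge0; [rewrite mulr_ge0 ?sqrtr_ge0|exact: ltW].
have lE : (h * (Num.sqrt N%:R * Num.sqrt u)) ^+ 2 = h ^+ 2 * (N%:R * u).
  by move: u0; move: u => t t0; rewrite !exprMn !sqr_sqrtr ?ler0n.
have rE : (M * Num.sqrt (N%:R * Num.sqrt N%:R / a) / Num.sqrt gamma) ^+ 2 =
    M ^+ 2 * (N%:R * Num.sqrt N%:R / a) / gamma.
  by move: w0; move: (_ / a) => t t0; rewrite !exprMn exprVn !sqr_sqrtr ?(ltW gamma0).
apply/eqP; rewrite -(@eqrXn2 _ 2)//.
- by rewrite lE rE; apply/eqP; field; rewrite !gt_eqF.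
- by rewrite !mulr_ge0 ?sqrtr_ge0 ?(ltW h0).
- by rewrite divr_ge0 ?mulr_ge0 ?sqrtr_ge0 ?(ltW M0).
Qed.

(** By contradiction: were [y] small, the Cauchy-Schwarz inequality would make
    [f] and [f0] close at the centres, hence on [B]; and their masses outside of
    [B] differ by little, so that the L1 distance could not reach [rho]. *)
Lemma squared_bias_large rho :
  2 * outside f0 + 15 / g + 2 * N%:R * h * x * (L * (6 * M + 2)) +
    120 * M / Num.sqrt gamma * Num.sqrt (N%:R * Num.sqrt N%:R / a) < rho ->
  (rho%:E <= l1_dist X f f0)%E -> outside f - outside f0 < 15 / g -> Y <= y.
Proof.
move=> rhoE rho1 tau; rewrite leNgt; apply/negP => yY.
have f0H' : holder X beta L f0.
  move=> z z' Xz Xz'; apply: le_trans (f0H Xz Xz') _; rewrite ler_wpM2r ?powR_ge0//.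
  by case/andP: L0L => _ /ltW.
have := le_trans rho1 (l1_dist_le BX GB beta01 (ltW L_ge0) fH f0H').
rewrite lee_fin => rho2.
have x0 : 0 <= x by exact: powR_ge0.
have u0 : 0 <= u by rewrite divr_ge0 ?ltW.
have Lx0 : 0 <= L * x by rewrite mulr_ge0 ?(ltW L_ge0).
have C2 := C_beta_le psi_bounded psi_support beta01.
have delta_le j : `|f (ctr G j) - f0 (ctr G j)| <= `|m j - f0 (ctr G j)| + L * x * (2 * M).
  have := smooth_bias psi_bounded psi_support psi_int BX GB beta01 fH (sm j).
  have := ler_wpM2l Lx0 C2; rewrite distrC.
  have := ler_normD (f (ctr G j) - m j) (m j - f0 (ctr G j)); rewrite subrKA; lra.
have S1 : \sum_j (`|f (ctr G j) - f0 (ctr G j)| + 2 * (L * x)) * (2 * h) <=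
    2 * h * (\sum_j `|m j - f0 (ctr G j)|) + 2 * N%:R * h * (L * x * (2 * M + 2)).
  have -> : 2 * N%:R * h * (L * x * (2 * M + 2)) =
      \sum_(j < N) (2 * h) * (L * x * (2 * M + 2)).
    by rewrite sumr_const card_ord -[in RHS]mulr_natl; ring.
  rewrite mulr_sumr -big_split; apply: ler_sum => j _ /=.
  rewrite -mulrDr mulrC; apply: ler_wpM2l; first by rewrite mulr_ge0// ltW.
  by have := delta_le j; lra.
have y0 : 0 <= y by apply: sumr_ge0 => j _; exact: sqr_ge0.
pose p := 4 * (L * M * x) * Num.sqrt N%:R.
pose r := 60 * Num.sqrt u.
have p0 : 0 <= p by rewrite !mulr_ge0 ?sqrtr_ge0 ?(ltW L_ge0) ?(ltW M0).
have r0 : 0 <= r by rewrite mulr_ge0 ?sqrtr_ge0.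
have sy : Num.sqrt y <= p + r.
  rewrite -[leRHS]ger0_norm ?addr_ge0// -sqrtr_sqr ler_wsqrtr//; apply: (le_trans (ltW yY)).
  have -> : Y = 12 * (L * M * x) ^+ 2 * N%:R + r ^+ 2.
    by rewrite /r (exprMn 2 60) sqr_sqrtr.
  have : p ^+ 2 = 16 * (L * M * x) ^+ 2 * N%:R.
    by rewrite /p !exprMn sqr_sqrtr ?ler0n//; ring.
  have := mulr_ge0 p0 r0; have : 0 <= (L * M * x) ^+ 2 * N%:R.
    by rewrite mulr_ge0 ?sqr_ge0.
  by rewrite sqrrD; lra.
have Sb := sum_norm_le_sqrt (fun j => m j - f0 (ctr G j)).
have Sb2 : h * \sum_j `|m j - f0 (ctr G j)| <=
    4 * N%:R * h * x * (L * M) + 60 * (M * Num.sqrt (N%:R * Num.sqrt N%:R / a) / Num.sqrt gamma).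
  rewrite -noise_sqrt; apply: (@le_trans _ _ (h * (Num.sqrt N%:R * (p + r)))).
    rewrite ler_wpM2l ?(ltW h0)//; apply: le_trans Sb _.
    by rewrite ler_wpM2l ?sqrtr_ge0.
  rewrite /p /r le_eqVlt; apply/orP; left; apply/eqP.
  rewrite -[X in _ = 4 * X * _ * _ * _ + _](@sqr_sqrtr _ N%:R) ?ler0n//; ring.
move: rhoE rho2 tau S1 Sb2; lra.
Qed.

End inside.
End type2.

(** * The separation rate *)

Section rate.
Context {R : realType} (alpha beta gamma L L0 c1 c2 : R) (psi : {mfun R >-> R}) (N : nat).
Context (G : grid R N) (n : nat) (X B : set R) (f0 : density X).
Hypothesis psi_bounded : exists M : R, forall u : R, `|psi u| <= M.
Hypothesis psi_support : forall u : R, ~ (-1 <= u <= 1) -> psi u = 0.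
Hypothesis psi_int : (\int[lebesgue_measure]_(u in `[(-1)%R, 1%R]) psi u)%R = 1.
Hypothesis gamma01 : 0 < gamma < 1.
Hypothesis alpha01 : 0 < alpha < 1.
Hypothesis beta01 : 0 < beta <= 1.
Hypothesis L0L : 0 < L0 < L.
Hypothesis n2 : (2 <= n)%N.
Hypothesis N1 : (1 <= N)%N.
Hypothesis f0H : holder X beta L0 f0.
Hypothesis BX : B `<=` X.
Hypothesis GB : grid_partition G B.
Hypotheses (c10 : 0 < c1) (c20 : 0 < c2).
Hypothesis hbw : c1 * bandwidth alpha beta n B <= hw G <= c2 * bandwidth alpha beta n B.
Local Notation M := (sup_norm psi).
Local Notation Q := (@mechanism R alpha psi N G n).
Local Notation phi := (Phi X G B f0 (thr1 alpha beta gamma L0 psi N n (hw G)) (thr2 alpha gamma n)).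
Local Notation a := (n%:R * alpha ^+ 2).
Local Notation outside f := (\int[lebesgue_measure]_(x in X `\` B) f x)%R.

Lemma sum_lt_mul_rate (r q i A D E : R) : 0 <= r -> 0 <= q -> 0 < i ->
  0 <= A -> 0 <= D -> 0 <= E ->
  2 * q + A * i + D * r + E * r < (3 + A + D + E) * (r + q + i).
Proof.
move=> r0 q0 i0 A0 D0 E0.
have := mulr_ge0 A0 (addr_ge0 r0 q0); have := mulr_ge0 D0 (addr_ge0 q0 (ltW i0)).
have := mulr_ge0 E0 (addr_ge0 q0 (ltW i0)); lra.
Qed.

(** The last three terms pay for the noise of [T_B], the bias and the noise of
    [S_B]; of the leading 3, two units pay for the mass of [f0] outside of [B] and the
    third makes the comparison strict. *)
Definition rate_constant : R :=
  3 + 15 / Num.sqrt gamma + Num.max 1 c2 * (`|L| * (6 * M + 2)) +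
  120 * M / Num.sqrt gamma * c1 `^ (- (3 / 4)).

Let a0 : 0 < a.
Proof. by rewrite mulr_gt0 ?exprn_gt0 ?ltr0n//; [case: n n2|case/andP: alpha01]. Qed.

Let h0 : 0 < hw G := hw_gt0 GB.

Let V0 : 0 < vol B.
Proof. by rewrite (vol_grid GB) !mulr_gt0// ltr0n. Qed.

Let q0 : 0 <= outside f0.
Proof. by apply: has_integral_ge0 (has_integral_outside GB f0) => x; rewrite indicE. Qed.

Lemma rate_gt0 : 0 < rate alpha beta X n f0 B.
Proof.
rewrite /rate ltr_wpDl ?addr_ge0 ?mulr_ge0 ?powR_ge0//.
by rewrite divr_gt0// sqrtr_gt0.
Qed.

Lemma rate_constant_gt0 : 0 < rate_constant.
Proof.
have M0 := sup_norm_ge0 psi_bounded.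
have m1 : 0 <= Num.max 1 c2 by rewrite le_max ler01.
rewrite /rate_constant !ltr_pwDl ?divr_ge0 ?mulr_ge0 ?sqrtr_ge0 ?powR_ge0 ?addr_ge0//.
by rewrite mulr_ge0.
Qed.

Lemma rate_dominates :
  2 * outside f0 + 15 / Num.sqrt (a * gamma) +
    2 * N%:R * hw G * hw G `^ beta * (L * (6 * M + 2)) +
    120 * M / Num.sqrt gamma * Num.sqrt (N%:R * Num.sqrt N%:R / a) <
  rate_constant * rate alpha beta X n f0 B.
Proof.
have /andP[hlo hhi] := hbw.
have /andP[g0 _] := gamma01; have /andP[L00 LL] := L0L.
have M0 := sup_norm_gt0 psi_bounded psi_int.
have L_gt0 := lt_trans L00 LL.
have sg0 : 0 < Num.sqrt gamma by rewrite sqrtr_gt0.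
have i0 : 0 < 1 / Num.sqrt a by rewrite divr_gt0 ?sqrtr_gt0.
have m0 : 0 <= Num.max 1 c2 by rewrite le_max ler01.
have LM0 : 0 <= L * (6 * M + 2).
  by rewrite mulr_ge0 ?(ltW L_gt0)// addr_ge0// mulr_ge0// ltW.
have := bias_rate V0 a0 beta01 h0 c20 hhi.
have NV : N%:R <= vol B / hw G.
  by rewrite ler_pdivlMr// (vol_grid GB) ler_wpM2r ?(ltW h0)// ler_peMl// ler1n.
have := noise_rate V0 a0 beta01 h0 c10 hlo (ler0n R N) NV.
set r := (X in _ <= _ * X -> _) => noise bias.
have r0 : 0 <= r by rewrite mulr_ge0 ?powR_ge0.
rewrite /rate -/r /rate_constant (gtr0_norm L_gt0).
apply: le_lt_trans (sum_lt_mul_rate r0 q0 i0 (A := 15 / Num.sqrt gamma)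
  (D := Num.max 1 c2 * (L * (6 * M + 2)))
  (E := 120 * M / Num.sqrt gamma * c1 `^ (- (3 / 4))) _ _ _); last 3 first.
- by rewrite divr_ge0// ltW.
- by rewrite mulr_ge0.
- by rewrite !mulr_ge0 ?invr_ge0 ?powR_ge0// ltW.
apply: lerD; last first.
  rewrite -[leRHS]mulrA; apply: ler_wpM2l noise.
  by rewrite divr_ge0 ?mulr_ge0// ltW.
apply: lerD; last first.
  rewrite -(vol_grid GB) [leRHS]mulrAC.
  by apply: ler_wpM2r.
rewrite lerD2l sqrtrM ?(ltW a0)// le_eqVlt; apply/orP; left; apply/eqP.
by field; rewrite !gt_eqF// sqrtr_gt0.
Qed.

Lemma type2_error_le f : alternatives beta L f0 (rate_constant * rate alpha beta X n f0 B) f ->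
  (type2_error Q phi f <= (gamma / 10)%:E)%E.
Proof.
move=> [fH fl1].
have [tau|tau] := leP (15 / Num.sqrt (a * gamma)) (outside f - outside f0).
  exact: (type2_error_outside beta L0 psi gamma01 alpha01 n2 GB tau).
have [m sm] := smooth_means psi_bounded psi_int GB f.
apply: (type2_error_inside (L := L) psi_bounded psi_support psi_int gamma01 alpha01 beta01 L0L
  n2 N1 GB sm).
exact: (squared_bias_large psi_bounded psi_support psi_int gamma01 alpha01 beta01 L0L n2 N1
  f0H fH BX GB sm rate_dominates fl1 tau).
Qed.

End rate.

Theorem theorem3p4 (R : realType) (L gamma c1 c2 : R) (psi : {mfun R >-> R})
  (hgamma : 0 < gamma < 1) (hc1 : 0 < c1) (hc2 : 0 < c2)
  (psi_bounded : exists M : R, forall u : R, `|psi u| <= M)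
  (psi_support : forall u : R, ~ (-1 <= u <= 1) -> psi u = 0)
  (psi_int : (\int[lebesgue_measure]_(u in `[(-1)%R, 1%R]) psi u)%R = 1) :
  exists C : R, 0 < C /\
  forall (alpha beta L0 : R) (X : set R) (f0 : density X) (n N : nat)
    (G : grid R N) (B : set R),
    0 < alpha < 1 -> 0 < beta <= 1 -> 0 < L0 < L -> (2 <= n)%N -> (1 <= N)%N ->
    holder X beta L0 f0 ->
    B `<=` X -> B !=set0 -> compact B -> grid_partition G B ->
    c1 * bandwidth alpha beta n B <= hw G <= c2 * bandwidth alpha beta n B ->
    (\int[lebesgue_measure]_(u in `[(-1)%R, 1%R])
        (`|u| `^ beta * `|psi u|)%:E < +oo)%E ->
    let Q := @mechanism R alpha psi N G n in
    let phi := Phi X G B f0 (thr1 alpha beta gamma L0 psi N n (hw G))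
                 (thr2 alpha gamma n) in
    let rho := C * rate alpha beta X n f0 B in
    [/\ forall i, ldp X alpha (Q i),
        measurable_fun [set: sample R N n] phi,
        (type1_error Q phi f0 +
          sup_nonneg [set type2_error Q phi f | f in alternatives beta L f0 rho] <= gamma%:E)%E &
        (separation_rate beta L (n + n) alpha f0 gamma <= rho%:E)%E].
Proof.
have g0 : 0 <= gamma / 10 by case/andP: hgamma => g0 _; rewrite divr_ge0// ltW.
exists (rate_constant gamma L c1 c2 psi); split; first exact: rate_constant_gt0.
move=> alpha beta L0 X f0 n N G B alpha01 beta01 L0L n2 N1 f0H BX _ _ GB hbw _ Q phi rho.
have M0 := sup_norm_gt0 psi_bounded psi_int.
have priv i : ldp X alpha (Q i).
  exact: (ldp_mechanism psi_bounded M0 (hw_gt0 GB) alpha01 (trivIset_cell GB)).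
have mphi : measurable_fun [set: sample R N n] phi by exact: measurable_Phi.
have err1 : (type1_error Q phi f0 <= (9 / 10 * gamma)%:E)%E.
  exact: (type1_error_le psi_bounded psi_support psi_int hgamma alpha01 beta01 n2 N1 f0H BX GB).
have err2 f : alternatives beta L f0 rho f -> (type2_error Q phi f <= (gamma / 10)%:E)%E.
  exact: (type2_error_le psi_bounded psi_support psi_int hgamma alpha01 beta01 L0L n2 N1 f0H
    BX GB hc1 hc2 hbw).
have gE : gamma%:E = ((9 / 10 * gamma)%:E + (gamma / 10)%:E)%E.
  by rewrite -EFinD; congr EFin; field.
split => //.
  rewrite gE; apply: leeD err1 _; apply: ge_ereal_sup => _ [[f ff <-]|->].
    exact: err2.
  by rewrite lee_fin.
apply: ereal_inf_lbound; exists rho => //; split.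
  rewrite /rho mulr_gt0 ?rate_constant_gt0//.
  exact: (rate_gt0 beta f0 alpha01 n2 GB).
apply: le_trans (_ : (sup_nonneg [set (type1_error Q phi f0 + type2_error Q phi f)%E
  | f in alternatives beta L f0 rho] <= _)%E); last first.
  apply: ge_ereal_sup => _ [[f ff <-]|->]; last first.
    by rewrite lee_fin; case/andP: hgamma => /ltW.
  by rewrite gE; apply: leeD err1 (err2 f ff).
by apply: ereal_inf_lbound; exists (fun i => out_disp R N (i < n)%N),
  (fun i => out R N (i < n)%N), Q, phi.
Qed.
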